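(* Let $(\widetilde{\mathcal T}_n)_{n\in\mathbb N}$ be a sequence of $\mathbb T$-valued random variables on a probability space with probability $\mathbf P$ such that for all $n\in\mathbb N$, $\mathbf P$-a.s. $\widetilde{\mathcal T}_n\preceq\widetilde{\mathcal T}_{n+1}$. Assume that for every fixed $a,h\in(0,\infty)$ the family of laws of the $\mathbb N$-valued random variables $Z^{(h)}_a(\widetilde{\mathcal T}_n)$, $n\in\mathbb N$, is tight. Then there exists a random tree $\widetilde{\mathcal T}$ in $\mathbb T$ such that $\mathbf P$-a.s. $\lim_{n\to\infty}\boldsymbol\delta(\widetilde{\mathcal T}_n,\widetilde{\mathcal T})=0$.
   Context: A rooted real tree is a metric space $(T,d)$ with a distinguished point $\rho\in T$ (the root) such that: (1) for all $\sigma,\sigma'\in T$ there is a unique isometry $f:[0,d(\sigma,\sigma')]\to T$ with $f(0)=\sigma$, $f(d(\sigma,\sigma'))=\sigma'$, whose image is denoted $[[\sigma,\sigma']]$; (2) every continuous injective $q:[0,1]\to T$ satisfies $q([0,1])=[[q(0),q(1)]]$. A CLCR real tree is a complete locally compact rooted real tree (its closed balls are then compact). Two CLCR real trees are equivalent if there is a root-preserving isometry from one onto the other; $\widetilde T$ is the equivalence class of $T$ and $\mathbb T$ is the set of all such classes. For compact pointed metric spaces, $\boldsymbol\delta_{\rm cpct}(X_1,X_2)=\inf\{d_{\rm Haus}(f_1(X_1),f_2(X_2))\vee d(f_1(\rho_1),f_2(\rho_2))\}$, the infimum being over all isometric embeddings $f_i:X_i\to E$ into a common metric space $(E,d)$,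 with $d_{\rm Haus}$ the Hausdorff distance. For CLCR real trees, $\boldsymbol\delta(T_1,T_2)=\sum_{k\ge1}2^{-k}\boldsymbol\delta_{\rm cpct}(\overline B_{T_1}(\rho_1,k),\overline B_{T_2}(\rho_2,k))$, where $\overline B_{T}(\rho,k)$ is the closed ball of centre $\rho$ and radius $k$. $(\mathbb T,\boldsymbol\delta)$ is a Polish space, equipped with its Borel $\sigma$-field. For $h\in(0,\infty)$, $R_h(T)=\{\rho\}\cup\{\sigma\in T:\exists\sigma'\in T,\ \sigma\in[[\rho,\sigma']],\ d(\sigma,\sigma')\ge h\}$, and $Z^{(h)}_a(T)=\#\{\sigma\in R_h(T):d(\rho,\sigma)=a\}$, which is finite for CLCR real trees and depends only on $\widetilde T$. For $\widetilde T,\widetilde T'\in\mathbb T$, $\widetilde T\preceq\widetilde T'$ means that there are representatives $(T,d,\rho)$ of $\widetilde T$ and $(T',d',\rho')$ of $\widetilde T'$ and an isometric embedding $f:T\hookrightarrow T'$ with $f(\rho)=\rho'$. *)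

(* Defs.v *)
From HB Require Import structures.
From mathcomp Require Import all_boot all_order all_algebra.
From mathcomp Require Import finmap.
From mathcomp Require Import all_classical all_reals all_analysis.

Set Implicit Arguments.
Unset Strict Implicit.
Unset Printing Implicit Defensive.

Import Order.TTheory GRing.Theory Num.Theory.
Import numFieldNormedType.Exports.

Local Open Scope classical_set_scope.
Local Open Scope ring_scope.
Local Open Scope quotient_scope.

Section metric_notions.
Context {R : realType}.

Definition isometric_embedding (X Y : metricType R) (f : X -> Y) :=
  forall x y, mdist (f x) (f y) = mdist x y.

Definition hausdorff_dist (E : metricType R) (A B : set E) : \bar R :=
  ereal_inf [set e%:E | e in [set e : R |
    [/\ 0 < e, A `<=` \bigcup_(y in B) ball y e
             & B `<=` \bigcup_(x in A) ball x e]]].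

Definition delta_cpct (X1 X2 : metricType R) (r1 : X1) (r2 : X2) : \bar R :=
  ereal_inf [set e | exists (E : metricType R) (f1 : X1 -> E) (f2 : X2 -> E),
    [/\ isometric_embedding f1, isometric_embedding f2
      & e = maxe (hausdorff_dist (range f1) (range f2))
                 (mdist (f1 r1) (f2 r2))%:E]].

(* The closed ball {y | d x y <= r} as a metric space for the restricted
   distance (the library's [closed_ball] is the closure of the open ball). *)
Definition ball_space (X : metricType R) (x : X) (r : R) : Type :=
  {y : X | mdist x y <= r}.

Section ball_space.
Variables (X : metricType R) (x : X) (r : R).

HB.instance Definition _ := [Choice of ball_space x r by <:].

Let bdist (y z : ball_space x r) : R := mdist (val y) (val z).

Let bdistxx y : bdist y y = 0. Proof. exact: mdistxx. Qed.

Let bdist_positivity y z : bdist y z = 0 -> y = z.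
Proof. by move=> /mdist_positivity/val_inj. Qed.

Let bdist_sym y z : bdist y z = bdist z y. Proof. exact: metric_sym. Qed.

Let bdist_triangle z y t : bdist y t <= bdist y z + bdist z t.
Proof. exact: metric_triangle. Qed.

HB.instance Definition _ := isMetric.Build R (ball_space x r)
  bdistxx bdist_positivity bdist_sym bdist_triangle.

End ball_space.

Lemma ball_root_subproof (X : metricType R) (x : X) (k : nat) :
  mdist x x <= k%:R :> R.
Proof. by rewrite mdistxx ler0n. Qed.

Definition ball_root (X : metricType R) (x : X) (k : nat) :
  ball_space x k%:R := exist _ x (ball_root_subproof x k).

(* [f] is only relevant on `[0, d(s, t)]. *)
Definition geodesic (X : metricType R) (s t : X) (f : R -> X) :=
  [/\ {in `[0, mdist s t] &, forall u v, mdist (f u) (f v) = `|u - v|},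
      f 0 = s & f (mdist s t) = t].

Definition segment (X : metricType R) (s t : X) : set X :=
  [set x | exists2 f : R -> X, geodesic s t f & (f @` `[0, mdist s t]) x].

Definition real_tree (X : metricType R) :=
  (forall s t : X, exists2 f : R -> X, geodesic s t f &
     forall g, geodesic s t g -> {in `[0, mdist s t], f =1 g}) /\
  (forall q : R -> X, {within `[0, 1], continuous q} ->
     {in `[0, 1] &, injective q} -> q @` `[0, 1] = segment (q 0) (q 1)).

Definition complete_space (X : metricType R) :=
  forall F : set_system X, ProperFilter F -> cauchy F -> exists x : X, F --> x.

End metric_notions.

(* In the library all structures share one universe, hence a quotient of a type
   of trees carried by [metricType]s could not be a [measurableType]. The metric
   spaces below have their points in a smaller universe; the coercion that
   follows makes them [metricType]s. Up to isometry this excludes no CLCR tree,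
   since such a tree has at most the cardinality of the continuum. *)
Record metric_space (R : realType) := MetricSpace {
  points : Type;
  dist : points -> points -> R;
  distxx : forall x, dist x x = 0;
  dist_positivity : forall x y, dist x y = 0 -> x = y;
  dist_sym : forall x y, dist x y = dist y x;
  dist_triangle : forall y x z, dist x z <= dist x y + dist y z }.

HB.instance Definition _ (R : realType) (M : metric_space R) :=
  gen_eqMixin (points M).
HB.instance Definition _ (R : realType) (M : metric_space R) :=
  gen_choiceMixin (points M).
HB.instance Definition _ (R : realType) (M : metric_space R) :=
  isMetric.Build R (points M) (@distxx R M) (@dist_positivity R M)
    (@dist_sym R M) (@dist_triangle R M).

Definition metric_space_metricType (R : realType) (M : metric_space R) :
  metricType R := points M.
Coercion metric_space_metricType : metric_space >-> metricType.

Record clcr_tree (R : realType) := ClcrTree {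
  tree_space :> metric_space R;
  root : tree_space;
  clcr_real_tree : real_tree tree_space;
  clcr_complete : complete_space tree_space;
  clcr_locally_compact : locally_compact [set: tree_space] }.
Arguments root {R} c.

HB.instance Definition _ (R : realType) := gen_eqMixin (clcr_tree R).
HB.instance Definition _ (R : realType) := gen_choiceMixin (clcr_tree R).

Definition rooted_isometric (R : realType) (T1 T2 : clcr_tree R) : Prop :=
  exists f : T1 -> T2,
    [/\ isometric_embedding f, f (root T1) = root T2 & range f = setT].

Definition tree_equiv (R : realType) : rel (clcr_tree R) :=
  fun T1 T2 => `[< rooted_isometric T1 T2 >].

Section tree_equiv.
Context {R : realType}.

Lemma isometric_embedding_inj (X Y : metricType R) (f : X -> Y) :
  isometric_embedding f -> injective f.
Proof.
by move=> fi x y fxy; apply: mdist_positivity; rewrite -fi fxy mdistxx.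
Qed.

Lemma rooted_isometric_refl (T : clcr_tree R) : rooted_isometric T T.
Proof. by exists id; split => //; rewrite image_id. Qed.

Lemma rooted_isometric_inv (T1 T2 : clcr_tree R) : rooted_isometric T1 T2 ->
  exists (f : T1 -> T2) (g : T2 -> T1), [/\ isometric_embedding f,
    isometric_embedding g, cancel f g, cancel g f &
    f (root T1) = root T2 /\ g (root T2) = root T1].
Proof.
move=> [f [fi fr fT]].
have fsurj y : exists x, f x = y.
  by have [x _ <-] : range f y by [rewrite fT]; exists x.
pose g y := sval (cid (fsurj y)).
have fg : cancel g f by move=> y; rewrite /g; case: cid.
have gf : cancel f g by move=> x; apply: (isometric_embedding_inj fi).
exists f, g; split=> //; first by move=> x y; rewrite -fi !fg.
by split=> //; rewrite -fr gf.
Qed.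

Lemma rooted_isometric_sym (T1 T2 : clcr_tree R) :
  rooted_isometric T1 T2 -> rooted_isometric T2 T1.
Proof.
move=> /rooted_isometric_inv[f [g [fi gi fg gf [fr gr]]]].
exists g; split=> //; apply/seteqP; split=> // x _; by exists (f x).
Qed.

Lemma rooted_isometric_trans (T2 T1 T3 : clcr_tree R) :
  rooted_isometric T1 T2 -> rooted_isometric T2 T3 -> rooted_isometric T1 T3.
Proof.
move=> [f [fi fr fT]] [g [gi gr gT]]; exists (g \o f); split => /=.
- by move=> x y; rewrite /= gi fi.
- by rewrite fr gr.
- by rewrite -image_comp fT.
Qed.

Lemma tree_equiv_refl : reflexive (@tree_equiv R).
Proof. by move=> T; apply/asboolP; exact: rooted_isometric_refl. Qed.

Lemma tree_equiv_sym : symmetric (@tree_equiv R).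
Proof.
by move=> T1 T2; apply/asboolP/asboolP; exact: rooted_isometric_sym.
Qed.

Lemma tree_equiv_trans : transitive (@tree_equiv R).
Proof.
move=> T2 T1 T3 /asboolP T12 /asboolP T23.
by apply/asboolP; exact: rooted_isometric_trans T23.
Qed.

End tree_equiv.

Canonical tree_equiv_equiv (R : realType) :=
  EquivRel (@tree_equiv R) tree_equiv_refl tree_equiv_sym tree_equiv_trans.

Definition tree_class (R : realType) : Type := {eq_quot (tree_equiv_equiv R)}.

HB.instance Definition _ (R : realType) := EqQuotient.on (tree_class R).
HB.instance Definition _ (R : realType) := Choice.on (tree_class R).

Section tree_functions.
Context {R : realType}.
Implicit Types T : clcr_tree R.

Definition tree_dist T1 T2 : \bar R :=
  (\sum_(1 <= k <oo) (2^-1 ^+ k)%:E *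
     delta_cpct (ball_root (root T1) k) (ball_root (root T2) k))%E.

Definition trim (h : R) T : set T :=
  root T |` [set s | exists s' : T, segment (root T) s' s /\ h <= mdist s s'].

(* The set is finite for every CLCR tree, so that [fset_set] is never used
   outside of its domain. *)
Definition tree_Z (h a : R) T : nat :=
  #|` fset_set [set s : T | trim h s /\ mdist (root T) s = a]|%fset.

Definition delta (t1 t2 : tree_class R) : \bar R :=
  tree_dist (repr t1) (repr t2).

Definition Z (h a : R) (t : tree_class R) : nat := tree_Z h a (repr t).

Definition preceq (t1 t2 : tree_class R) : Prop :=
  exists T1 T2, [/\ \pi_(tree_class R) T1 = t1, \pi_(tree_class R) T2 = t2 &
    exists2 f : T1 -> T2, isometric_embedding f & f (root T1) = root T2].

End tree_functions.

(* The choices of representatives in [delta] and [Z] are immaterial. *)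
Section representatives.
Context {R : realType}.

Lemma le_delta_cpct (X1 X2 Y1 Y2 : metricType R) (r1 : X1) (r2 : X2)
    (s1 : Y1) (s2 : Y2) (g1 : Y1 -> X1) (g2 : Y2 -> X2) :
  isometric_embedding g1 -> g1 s1 = r1 -> range g1 = setT ->
  isometric_embedding g2 -> g2 s2 = r2 -> range g2 = setT ->
  (delta_cpct s1 s2 <= delta_cpct r1 r2)%E.
Proof.
move=> i1 <- g1T i2 <- g2T; apply: ereal_inf_le_tmp => _ [E [f1 [f2 [j1 j2 ->]]]].
exists E, (f1 \o g1), (f2 \o g2); split.
- by move=> x y /=; rewrite j1 i1.
- by move=> x y /=; rewrite j2 i2.
- by rewrite -(image_comp g1 f1) -(image_comp g2 f2) g1T g2T.
Qed.

Lemma rooted_isometric_ball (T1 T2 : clcr_tree R) (k : nat) :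
  rooted_isometric T1 T2 ->
  exists g : ball_space (root T1) k%:R -> ball_space (root T2) k%:R,
    [/\ isometric_embedding g, g (ball_root (root T1) k) = ball_root (root T2) k
      & range g = setT].
Proof.
move=> /rooted_isometric_inv[f [g [fi gi fg gf [fr gr]]]].
have fk (x : ball_space (root T1) k%:R) : mdist (root T2) (f (val x)) <= k%:R.
  by rewrite -fr fi; exact: valP x.
have gk (x : ball_space (root T2) k%:R) : mdist (root T1) (g (val x)) <= k%:R.
  by rewrite -gr gi; exact: valP x.
exists (fun x => exist _ (f (val x)) (fk x)); split.
- by move=> x y; exact: fi.
- by apply: val_inj.
- apply/seteqP; split=> // y _.
  by exists (exist _ (g (val y)) (gk y)) => //; apply: val_inj => /=; rewrite gf.
Qed.

Lemma tree_dist_isom (T1 T2 U1 U2 : clcr_tree R) :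
  rooted_isometric T1 U1 -> rooted_isometric T2 U2 ->
  tree_dist T1 T2 = tree_dist U1 U2.
Proof.
move=> TU1 TU2; apply: eq_eseriesr => k _; congr *%E.
have /rooted_isometric_sym UT1 := TU1; have /rooted_isometric_sym UT2 := TU2.
apply/eqP; rewrite eq_le; apply/andP; split.
- have [g1 [? ? ?]] := rooted_isometric_ball k TU1.
  have [g2 [? ? ?]] := rooted_isometric_ball k TU2.
  exact: (@le_delta_cpct _ _ _ _ _ _ _ _ g1 g2).
- have [g1 [? ? ?]] := rooted_isometric_ball k UT1.
  have [g2 [? ? ?]] := rooted_isometric_ball k UT2.
  exact: (@le_delta_cpct _ _ _ _ _ _ _ _ g1 g2).
Qed.

Lemma repr_pi_isom (T : clcr_tree R) :
  rooted_isometric (repr (\pi_(tree_class R) T)) T.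
Proof. by apply/asboolP/(eqmodP (tree_equiv_equiv R)); rewrite reprK. Qed.

Lemma delta_pi (T1 T2 : clcr_tree R) :
  delta (\pi_(tree_class R) T1) (\pi_(tree_class R) T2) = tree_dist T1 T2.
Proof. by apply: tree_dist_isom; exact: repr_pi_isom. Qed.

Lemma segment_isom (T1 T2 : clcr_tree R) (f : T1 -> T2) (s t x : T1) :
  isometric_embedding f -> segment s t x -> segment (f s) (f t) (f x).
Proof.
move=> fi [p [pi p0 pt] [u uI <-]]; exists (f \o p).
  by split => /=; rewrite ?fi ?p0 ?pt// => v w vI wI; rewrite fi pi.
by exists u => //; rewrite fi.
Qed.

Lemma tree_Z_isom (h a : R) (T1 T2 : clcr_tree R) :
  rooted_isometric T1 T2 -> tree_Z h a T1 = tree_Z h a T2.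
Proof.
move=> /rooted_isometric_inv[f [g [fi gi fg gf [fr gr]]]].
pose A (T : clcr_tree R) := [set s : T | trim h s /\ mdist (root T) s = a].
have AfA (T T' : clcr_tree R) (e : T -> T') : isometric_embedding e ->
    e (root T) = root T' -> forall x, A T x -> A T' (e x).
  move=> ei er x [Rx xa]; split; last by rewrite -er ei.
  case: Rx => [->|[y [rxy hy]]]; first by left.
  by right; exists (e y); rewrite -er ei; split => //; exact: segment_isom.
have fA : f @` A T1 = A T2.
  apply/seteqP; split=> [_ [x Ax <-]|y Ay]; first exact: AfA.
  by exists (g y) => //; exact: AfA.
have finj : injective f by exact: can_inj fg.
rewrite /tree_Z -/(A T1) -/(A T2) -fA.
have [Afin|Ainf] := pselect (finite_set (A T1)).
  rewrite fset_set_image// card_imfset//.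
rewrite /fset_set; case: pselect => // _; case: pselect => //.
move=> fAfin; exfalso; apply: Ainf.
have : finite_set (g @` (f @` A T1)) by exact: finite_image.
suff -> : g @` (f @` A T1) = A T1 by [].
apply/seteqP; split=> [_ [_ [x Ax <-] <-]|x Ax]; first by rewrite fg.
by exists (f x) => //; exists x.
Qed.

Lemma Z_pi (h a : R) (T : clcr_tree R) :
  Z h a (\pi_(tree_class R) T) = tree_Z h a T.
Proof. by apply: tree_Z_isom; exact: repr_pi_isom. Qed.

End representatives.

Section point_tree.
Variable R : realType.

Definition point_space : metric_space R :=
  @MetricSpace R unit (fun _ _ => 0) (fun=> erefl)
    (fun x y _ => match x, y with tt, tt => erefl end) (fun _ _ => erefl)
    (fun _ _ _ => ler_wpDr (lexx 0) (lexx 0)).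

Let point_real_tree : real_tree point_space.
Proof.
have ptE (x y : point_space) : x = y by case: x; case: y.
split=> [s t|q _ qinj].
  exists (fun=> s) => [|g _ u _]; last exact: ptE.
  split=> [u v|//|]; last exact: ptE.
  rewrite !in_itv/= => /andP[u0 u1] /andP[v0 v1].
  have -> : u = 0 by apply/eqP; rewrite eq_le u0 andbT.
  have -> : v = 0 by apply/eqP; rewrite eq_le v0 andbT.
  by rewrite subrr normr0.
have : 0 = 1 :> R.
  by apply: qinj; rewrite ?in_itv/= ?lexx ?ler01//; exact: ptE.
by move=> /eqP; rewrite eq_sym oner_eq0.
Qed.

Let point_complete : complete_space point_space.
Proof.
move=> F FF _; exists (tt : point_space) => A nA.
have Att := nbhs_singleton nA.
by rewrite (_ : A = setT); [exact: filterT|apply/seteqP; split=> // -[]].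
Qed.

Let point_locally_compact : locally_compact [set: point_space].
Proof.
move=> x _; exists setT; first exact: filterT.
split; last exact: closedT.
move=> F FF _; exists x; split=> // A B FA nB.
have Bx := nbhs_singleton nB.
have [y Ay] := filter_ex FA; exists y; split=> //.
by case: x y Bx {nB Ay} => [] [].
Qed.

Definition point_tree : clcr_tree R := @ClcrTree R point_space
  (tt : point_space) point_real_tree point_complete point_locally_compact.

HB.instance Definition _ :=
  isPointed.Build (tree_class R) (\pi_(tree_class R) point_tree).

End point_tree.

Section borel.
Variable R : realType.

Definition delta_open : set (set (tree_class R)) :=
  [set U | forall t, U t ->
     exists2 e : R, 0 < e & forall t', (delta t t' < e%:E)%E -> U t'].

(* The set of classes of CLCR trees with its Borel sigma-field. *)
Definition borel_tree : measurableType (sigma_display delta_open) :=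
  g_sigma_algebraType delta_open.

End borel.

Definition tight (R : realType) (I : Type) (E : topologicalType)
    (mu : I -> set E -> \bar R) :=
  forall e : R, 0 < e -> exists2 K : set E, compact K &
    forall i, (mu i (~` K) <= e%:E)%E.

(* Main.v *)
(* Real trees are the geodesic spaces satisfying Gromov's four point condition,
   which passes to completions: hence the completion C of the union of an
   increasing chain of trees is again a real tree. Every point of height in
   [i h, (i + 1) h) with i > 1 is within 2h of an ancestor in R_h of height
   (i - 1) h, so bounds on Z^(h)_a for h = 1/(m+1) and a a multiple of h make
   the balls of C totally bounded, by nets that already lie in one tree of the
   chain; this yields both the local compactness of C and the convergence to C.
   These bounds hold almost surely since Z^(h)_a increases along the chain and
   its laws are tight. Almost sure bounds require Z^(h)_a to be measurable: the
   event Z^(h)_a >= m is a countable intersection of open sets of trees. *)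

Require Import Defs.
From HB Require Import structures.
From mathcomp Require Import all_boot all_order all_algebra.
From mathcomp Require Import finmap lra.
From mathcomp Require Import all_classical all_reals all_analysis.

Set Implicit Arguments.
Unset Strict Implicit.
Unset Printing Implicit Defensive.

Import Order.TTheory GRing.Theory Num.Theory.
Import numFieldNormedType.Exports.

Local Open Scope classical_set_scope.
Local Open Scope ring_scope.
Local Notation root := Defs.root.

(** * Real trees and the four point condition *)

Section four_point.
Context {R : realType}.
Implicit Types X : metricType R.

(* The Gromov form of 0-hyperbolicity. *)
Definition four_point X := forall x y z w : X,
  mdist x z + mdist y w <= mdist x y + mdist z w \/
  mdist x z + mdist y w <= mdist x w + mdist y z.

Definition geodesic_space X := forall s t : X, exists f, geodesic s t f.

Definition between X (s t x : X) := mdist s x + mdist x t = mdist s t.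

Lemma geodesic_source X (s t : X) f u : geodesic s t f ->
  0 <= u <= mdist s t -> mdist s (f u) = u.
Proof.
move=> [fi f0 _] /andP[u0 u1].
by rewrite -[in LHS]f0 fi ?in_itv/= ?lexx ?mdist_ge0 ?u0// sub0r normrN ger0_norm.
Qed.

Lemma geodesic_target X (s t : X) f u : geodesic s t f ->
  0 <= u <= mdist s t -> mdist (f u) t = mdist s t - u.
Proof.
move=> [fi _ ft] /andP[u0 u1].
rewrite -[in LHS]ft fi ?in_itv/= ?lexx ?mdist_ge0 ?u0//.
by rewrite distrC ger0_norm ?subr_ge0.
Qed.

Lemma geodesic_between X (s t : X) f u : geodesic s t f ->
  0 <= u <= mdist s t -> between s t (f u).
Proof.
move=> fst ust; rewrite /between (geodesic_source fst ust).
by rewrite (geodesic_target fst ust); lra.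
Qed.

Lemma segment_between X (s t x : X) : segment s t x -> between s t x.
Proof.
move=> [f fst [u]]; rewrite /= in_itv/= => ust <-.
exact: (geodesic_between fst).
Qed.

Lemma geodesic_prefix X (s t : X) f u : geodesic s t f ->
  0 <= u <= mdist s t -> geodesic s (f u) f.
Proof.
move=> fst ust; have fu := geodesic_source fst ust.
have [fi f0 ft] := fst; case/andP: ust => u0 u1.
split=> //; rewrite fu // => v w; rewrite !in_itv/= => /andP[v0 v1] /andP[w0 w1].
by apply: fi; rewrite in_itv/= ?v0 ?w0/=; lra.
Qed.

Definition eps_continuous X (q : R -> X) (a b : R) := forall c, a <= c <= b ->
  forall e, 0 < e -> exists2 d, 0 < d &
    forall r, a <= r <= b -> `|r - c| < d -> mdist (q c) (q r) < e.

Lemma within_continuous_eps X (q : R -> X) (a b : R) :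
  {within `[a, b], continuous q} <-> eps_continuous q a b.
Proof.
split=> [/subspace_continuousP qc c cab e e0|qc].
  have : [set` `[a, b]] c by rewrite /= in_itv.
  move=> /qc/metricType_numDomainType.cvgrPdist_lt/(_ e e0).
  rewrite near_withinE => /nbhs_ballP[d d0 dq]; exists d => // r rab rc.
  by apply: dq; rewrite /= ?in_itv// /ball/= distrC.
apply/subspace_continuousP => c; rewrite /= in_itv/= => cab.
apply/metricType_numDomainType.cvgrPdist_lt => e e0; rewrite near_withinE.
have [d d0 dq] := qc c cab e e0; apply/nbhs_ballP; exists d => // r /= rc.
by rewrite in_itv/= => rab; apply: dq => //; rewrite distrC.
Qed.

End four_point.

Section real_tree_four_point.
Context {R : realType} (X : metricType R).
Hypothesis Xtree : real_tree X.

Let geo_unique (s t : X) f g : geodesic s t f -> geodesic s t g ->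
  forall u, 0 <= u <= mdist s t -> f u = g u.
Proof.
move=> fst gst u ust; have [k kst ku] := Xtree.1 s t.
by rewrite -(ku _ fst) ?in_itv// -(ku _ gst) ?in_itv.
Qed.

Let geo_meet (s x y : X) f g u v : geodesic s x f -> geodesic s y g ->
  0 <= u <= mdist s x -> 0 <= v <= mdist s y -> f u = g v ->
  u = v /\ forall w, 0 <= w <= u -> f w = g w.
Proof.
move=> fx gy ux vy fgu.
have uv : u = v.
  by rewrite -(geodesic_source fx ux) fgu (geodesic_source gy vy).
subst v; split=> // w wu.
apply: (@geo_unique s (f u)); first exact: geodesic_prefix fx ux.
  by rewrite fgu; exact: geodesic_prefix gy vy.
by rewrite (geodesic_source fx ux).
Qed.

(* [c] is the height of the branching point of [x] and [y] seen from [s]; the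
   arc formed by the two remaining branches is injective, hence a segment. *)
Let geo_branch (s x y : X) f g : geodesic s x f -> geodesic s y g ->
  exists c, [/\ 0 <= c <= mdist s x, c <= mdist s y, f c = g c,
     (forall u, 0 <= u -> u <= mdist s x -> u <= mdist s y ->
        f u = g u -> u <= c)
     & mdist x y = mdist s x + mdist s y - c - c].
Proof.
move=> fx gy.
pose A := [set u | [/\ 0 <= u, u <= mdist s x, u <= mdist s y & f u = g u]].
have A0 : A 0.
  by split; rewrite ?mdist_ge0//; case: fx => _ -> _; case: gy => _ -> _.
have Aub : has_ubound A by exists (mdist s x) => u [].
have As : has_sup A by split=> //; exists 0.
pose c := sup A.
have c0 : 0 <= c by apply: ub_le_sup.
have cx : c <= mdist s x by apply: ge_sup => [|u []//]; exists 0.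
have cy : c <= mdist s y by apply: ge_sup => [|u []//]; exists 0.
have fgc : f c = g c.
  apply: mdist_positivity; apply/eqP; rewrite eq_le mdist_ge0 andbT.
  apply/ler_addgt0Pl => e e0; rewrite addr0.
  have e20 : 0 < e / 2 by lra.
  have [u [u0 ux uy fgu] cu] := sup_adherent e20 As.
  have uc : u <= c by apply: ub_le_sup.
  rewrite (le_trans (metric_triangle _ (f u) _))// {2}fgu.
  case: fx => [fi _ _]; case: gy => [gi _ _].
  rewrite fi ?gi ?in_itv/= ?c0 ?u0// distrC ler0_norm; last by lra.
  by rewrite -/c in cu; lra.
exists c; split; rewrite ?c0//; first by move=> u *; apply: ub_le_sup.
pose L := mdist s x + mdist s y - c - c.
rewrite -/L; have L0 : 0 <= L by rewrite /L; lra.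
have [L00|Ln0] := eqVneq L 0.
  have [ex ey] : c = mdist s x /\ c = mdist s y by rewrite /L in L00; split; lra.
  have -> : x = y.
    by case: fx fgc => [_ _ <-]; case: gy => [_ _ <-]; rewrite -ex -ey.
  by rewrite mdistxx L00.
have {}L0 : 0 < L by rewrite lt_neqAle eq_sym Ln0.
pose k := mdist s x - c.
pose p t := if t <= k then f (mdist s x - t) else g (c + (t - k)).
have [fi f0 f1] := fx; have [gi g0 g1] := gy.
have pf t t' : 0 <= t -> t <= k -> 0 <= t' -> t' <= k ->
    mdist (p t) (p t') = `|t - t'|.
  rewrite /k => *; rewrite /p !ifT// fi ?in_itv/=; [|lra..].
  by rewrite distrC; congr `|_|; lra.
have pg t t' : k < t -> t <= L -> k < t' -> t' <= L ->
    mdist (p t) (p t') = `|t - t'|.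
  move=> kt tL kt' tL'; rewrite /p !ifF; [|by apply/negbTE; rewrite -ltNge..].
  rewrite gi ?in_itv/=; [|rewrite /L /k in kt kt' tL tL' *; lra..].
  by congr `|_|; lra.
have pfg t t' : 0 <= t -> t <= k -> k < t' -> t' <= L ->
    mdist (p t) (p t') <= t' - t.
  move=> t0 tk kt' tL'; rewrite (le_trans (metric_triangle _ (f c) _))//.
  rewrite /p tk ifF; last by apply/negbTE; rewrite -ltNge.
  rewrite {2}fgc fi ?gi ?in_itv/=; [|rewrite /L /k in tk kt' tL' *; lra..].
  rewrite ger0_norm ?ler0_norm/k; [|rewrite /k in tk kt' *; lra..].
  lra.
have pL t t' : 0 <= t <= L -> 0 <= t' <= L -> mdist (p t) (p t') <= `|t - t'|.
  move=> /andP[t0 tL] /andP[t'0 t'L].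
  have [tk|tk] := leP t k; have [tk'|tk'] := leP t' k.
  - by rewrite pf.
  - rewrite (le_trans (pfg _ _ _ _ _ _))// distrC ger0_norm//; lra.
  - rewrite metric_sym (le_trans (pfg _ _ _ _ _ _))// ger0_norm//; lra.
  - by rewrite pg.
have pmix t t' : 0 <= t -> t <= k -> k < t' -> t' <= L -> p t <> p t'.
  move=> t0 tk kt' tL'; rewrite /p tk ifF; last by apply/negbTE; rewrite -ltNge.
  have vx : 0 <= mdist s x - t <= mdist s x by rewrite /k in tk; lra.
  have vy : 0 <= c + (t' - k) <= mdist s y by rewrite /k /L in kt' tL' *; lra.
  move=> fgt; have [e _] := geo_meet fx gy vx vy fgt.
  suff : c + (t' - k) <= c by lra.
  apply: ub_le_sup => //; split; [lra|lra|lra|].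
  by rewrite -fgt e.
have pinj t t' : 0 <= t <= L -> 0 <= t' <= L -> p t = p t' -> t = t'.
  move=> /andP[t0 tL] /andP[t'0 t'L] ptt.
  have ptt0 : mdist (p t) (p t') = 0 by rewrite ptt mdistxx.
  have [tk|tk] := leP t k; have [tk'|tk'] := leP t' k.
  - by apply/eqP; rewrite -subr_eq0 -normr_eq0 -pf// ptt0.
  - by exfalso; exact: (pmix t t').
  - by exfalso; exact: (pmix t' t).
  - by apply/eqP; rewrite -subr_eq0 -normr_eq0 -pg// ptt0.
pose q r := p (r * L).
have rL r : 0 <= r <= 1 -> 0 <= r * L <= L.
  by move=> /andP[r0 r1]; rewrite mulr_ge0 ?(ltW L0)//= ler_piMl// ltW.
have qc : {within `[0, 1], continuous q}.
  apply/within_continuous_eps => a a01 e e0; exists (e / L); first exact: divr_gt0.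
  move=> r r01 ra; rewrite /q (le_lt_trans (pL _ _ (rL _ _) (rL _ _)))//.
  by rewrite -mulrBl normrM (gtr0_norm L0) -ltr_pdivlMr// distrC.
have qi : {in `[0, 1] &, injective q}.
  move=> r r'; rewrite !in_itv/= => r01 r'01 /pinj-/(_ (rL _ r01) (rL _ r'01)).
  exact/mulIf/lt0r_neq0.
have q0 : q 0 = x by rewrite /q mul0r /p ifT ?subr0// /k; lra.
have q1 : q 1 = y.
  rewrite /q mul1r /p; case: ifPn => [Lk|_]; last first.
    by rewrite -[RHS]g1; congr g; rewrite /L /k; lra.
  have e : mdist s y = c by rewrite /L /k in Lk; lra.
  have -> : mdist s x - L = c by rewrite /L; lra.
  by rewrite fgc -e.
have : segment x y (f c).
  rewrite -q0 -q1 -(Xtree.2 q qc qi); exists (k / L).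
    rewrite /= in_itv/= ler_pdivlMr// mul0r ler_pdivrMr// mul1r /k /L.
    by apply/andP; split; lra.
  rewrite /q divfK// /p lexx; congr f; rewrite /k; lra.
move=> /segment_between <-.
rewrite metric_sym (geodesic_target fx) ?c0// fgc (geodesic_target gy) ?c0//.
by rewrite /L; lra.
Qed.

Lemma real_tree_four_point : four_point X.
Proof.
move=> x y z s.
have [f fx _] := Xtree.1 s x; have [g gy _] := Xtree.1 s y.
have [h hz _] := Xtree.1 s z.
have [a [/andP[a0 ax_] ay fga amax dxy]] := geo_branch fx gy.
have [b [/andP[b0 bx_] by_ ghb bmax dyz]] := geo_branch gy hz.
have [c [/andP[c0 cx] cz fhc cmax dxz]] := geo_branch fx hz.
have := metric_sym s x; have := metric_sym s y; have := metric_sym s z.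
have aub : forall w, 0 <= w <= a -> f w = g w.
  by case: (geo_meet fx gy _ _ fga); rewrite ?a0.
have bub : forall w, 0 <= w <= b -> g w = h w.
  by case: (geo_meet gy hz _ _ ghb); rewrite ?b0.
have [ab|ba] := leP a b; [have ca : a <= c|have cb : b <= c].
- by apply: cmax => //; [lra|rewrite aub ?bub ?a0 ?ab/=].
- by move=> *; left; lra.
- by apply: cmax => //; [lra|rewrite aub ?bub ?b0//=; lra].
- by move=> *; right; lra.
Qed.

End real_tree_four_point.

Section four_point_real_tree.
Context {R : realType} (X : metricType R).
Hypothesis X4 : four_point X.

Lemma between_dist (s t x y : X) : between s t x -> between s t y ->
  mdist x y <= `|mdist s x - mdist s y|.
Proof.
rewrite /between => sxt syt.
have := X4 x s y t; rewrite (metric_sym x s).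
have := ler_norm (mdist s x - mdist s y).
have := ler_norm (mdist s y - mdist s x); rewrite (distrC (mdist s y)).
by move=> ? ? [] ?; lra.
Qed.

Lemma between_eq (s t x y : X) : between s t x -> between s t y ->
  mdist s x = mdist s y -> x = y.
Proof.
move=> sxt syt sxy; apply: mdist_positivity; apply/eqP.
rewrite eq_le mdist_ge0 andbT.
by rewrite (le_trans (between_dist sxt syt))// sxy subrr normr0.
Qed.

(* The level sets of [y |-> d(s, y) - d(y, t)] through [p] are open away from
   [p]: an arc from one of them to another passes through [p]. *)
Let leave_side (s t p x y : X) : between s t p ->
  mdist s x - mdist x t = mdist s p - mdist p t ->
  mdist s y - mdist y t < mdist s p - mdist p t -> mdist x p <= mdist x y.
Proof.
rewrite /between => spt xp yp.
have := metric_sym s p; have := metric_sym s x; have := metric_sym s y.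
have := metric_sym p t; have := metric_sym x y; have := metric_sym y t.
have := metric_sym p y.
have := metric_triangle x p s; have := metric_triangle y p t.
have := mdist_ge0 p y.
by move: (X4 x s p t) (X4 y s p t) (X4 x y s t) => [] ? [] ? [] ? *; lra.
Qed.

Let side_locally_constant (s t p x y : X) : between s t p ->
  mdist s x - mdist x t = mdist s p - mdist p t ->
  mdist x y < mdist x p ->
  mdist s y - mdist y t = mdist s p - mdist p t.
Proof.
move=> spt xp xy.
have [yp|yp|//] := ltgtP (mdist s y - mdist y t) (mdist s p - mdist p t).
- by have := leave_side spt xp yp => *; lra.
- have tps : between t s p.
    by move: spt; rewrite /between !(metric_sym t) (metric_sym s p) => *; lra.
  suff : mdist x p <= mdist x y by lra.
  by apply: (leave_side tps); rewrite !(metric_sym t) !(metric_sym _ s) => *; lra.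
Qed.

Lemma path_hits (q : R -> X) (a b : R) p : a <= b -> eps_continuous q a b ->
  between (q a) (q b) p -> exists2 r, a <= r <= b & q r = p.
Proof.
set s := q a; set t := q b => ab qc spt.
apply: contrapT => nohit.
have qp r : a <= r <= b -> 0 < mdist (q r) p.
  move=> rab; rewrite mdist_gt0; apply/eqP => qrp; apply: nohit.
  by exists r.
pose g x := mdist s x - mdist x t; pose v := g p.
have gL x y : `|g x - g y| <= 2 * mdist x y.
  rewrite /g ler_norml.
  have := metric_triangle s x y; have := metric_triangle s y x.
  have := metric_triangle y x t; have := metric_triangle x y t.
  by rewrite (metric_sym y x) => *; apply/andP; split; lra.
have sp : 0 < mdist s p by apply: qp; rewrite lexx.
have tp : 0 < mdist t p by apply: qp; rewrite lexx ab.
pose S := [set r | a <= r <= b /\ g (q r) < v].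
have Sa : S a.
  split; first by rewrite lexx.
  rewrite /g -/s mdistxx /v /g; move: spt; rewrite /between => *; lra.
have Sb : has_ubound S by exists b => r [/andP[]].
have hS : has_sup S by split=> //; exists a.
pose c := sup S.
have ac : a <= c by apply: ub_le_sup.
have cb : c <= b by apply: ge_sup => [|r [/andP[]]//]; exists a.
have cab : a <= c <= b by rewrite ac.
have [gc|gc|gc] := ltgtP (g (q c)) v.
- have e0 : 0 < (v - g (q c)) / 2 by lra.
  have [d d0 dq] := qc c cab _ e0.
  have {}cb : c < b.
    rewrite lt_neqAle cb andbT; apply/eqP => cb'; move: gc.
    rewrite cb' /v /g -/t mdistxx; move: spt.
    by rewrite /between (metric_sym p t) => *; lra.
  pose r := Order.min b (c + d / 2).
  have cr : c < r by rewrite /r lt_min cb; lra.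
  have rb : r <= b by rewrite /r ge_min lexx.
  have rd : r <= c + d / 2 by rewrite /r ge_min lexx orbT.
  suff : r <= c by lra.
  apply: ub_le_sup => //; split; first by rewrite rb; lra.
  have := dq r; rewrite gtr0_norm; last by lra.
  rewrite rb andbT => /(_ ltac:(lra) ltac:(lra)).
  have := gL (q c) (q r); rewrite ler_norml => /andP[] *; lra.
- have e0 : 0 < (g (q c) - v) / 2 by lra.
  have [d d0 dq] := qc c cab _ e0.
  have [r [rab gr] cr] := sup_adherent d0 hS.
  have rc : r <= c by apply: ub_le_sup.
  have := dq r rab; rewrite ler0_norm; last by lra.
  rewrite -/c in cr; move=> /(_ ltac:(lra)).
  have := gL (q c) (q r); rewrite ler_norml => /andP[] *; lra.
- have [d d0 dq] := qc c cab _ (qp c cab).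
  have [r [rab gr] cr] := sup_adherent d0 hS.
  have rc : r <= c by apply: ub_le_sup.
  have := dq r rab; rewrite ler0_norm; last by lra.
  rewrite -/c in cr; move=> /(_ ltac:(lra)).
  by move=> /(side_locally_constant spt gc); rewrite -/(g _) -/(g _) -/v => *; lra.
Qed.

Hypothesis Xgeo : geodesic_space X.

Lemma segmentE (s t x : X) : segment s t x <-> between s t x.
Proof.
split=> [/segment_between//|sxt]; have [f fst] := Xgeo s t.
have sx : 0 <= mdist s x <= mdist s t.
  by move: sxt; rewrite /between mdist_ge0/= => <-; rewrite lerDl mdist_ge0.
exists f => //; exists (mdist s x); first by rewrite /= in_itv.
apply: (between_eq (geodesic_between fst sx) sxt).
by rewrite (geodesic_source fst sx).
Qed.

Lemma tripod_center (s t x : X) : exists p,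
  [/\ between s t p, between s x p & between x t p].
Proof.
have [f fst] := Xgeo s t.
pose u := (mdist s t + mdist s x - mdist x t) / 2.
have ust : 0 <= u <= mdist s t.
  have := metric_triangle s x t; have := metric_triangle x s t.
  have := metric_triangle s t x.
  by rewrite (metric_sym x s) (metric_sym t x) /u => *; apply/andP; split; lra.
exists (f u); split; first exact: geodesic_between fst ust.
all: have := geodesic_target fst ust; have := geodesic_source fst ust.
all: have := metric_triangle s (f u) x; have := metric_triangle x (f u) t.
all: have := metric_sym x (f u); have := metric_sym x s.
all: rewrite /between; move: (X4 x s (f u) t); rewrite /u.
all: by move=> [] *; lra.
Qed.

Lemma four_point_real_tree : real_tree X.
Proof.
split=> [s t|q /within_continuous_eps qc qi].
  have [f fst] := Xgeo s t; exists f => // g gst u; rewrite in_itv/= => ust.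
  apply: (between_eq (geodesic_between fst ust) (geodesic_between gst ust)).
  by rewrite (geodesic_source fst) ?(geodesic_source gst).
have qcab a b : 0 <= a -> b <= 1 -> eps_continuous q a b.
  move=> a0 b1 c /andP[ac cb] e e0.
  have [|d d0 dq] := qc c _ e e0; first by rewrite (le_trans a0)// (le_trans cb).
  exists d => // r /andP[ar rb] rd; apply: dq => //.
  by rewrite (le_trans a0)// (le_trans rb).
apply/seteqP; split=> [_ [r + <-]|p /segment_between p01].
  rewrite /= in_itv/= => /andP[r0 r1]; apply/segmentE.
  have [p [stp sxp xtp]] := tripod_center (q 0) (q 1) (q r).
  have [r' /andP[r'0 r'r] r'p] := path_hits r0 (qcab _ _ (lexx 0) r1) sxp.
  have [r2 /andP[rr2 r21] r2p] := path_hits r1 (qcab _ _ r0 (lexx 1)) xtp.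
  have : r' = r2.
    by apply: qi; rewrite ?in_itv/= ?r'0 ?r21 ?andbT ?r'p//; lra.
  by move=> r'2; have -> : r = r'; [lra|rewrite r'p].
have [r r01 rp] := path_hits ler01 (qcab _ _ (lexx 0) (lexx 1)) p01.
by exists r => //; rewrite /= in_itv.
Qed.

End four_point_real_tree.

(** * Compactness of balls *)

Section totally_bounded.
Context {R : realType}.
Implicit Types X : metricType R.

Definition totally_bounded X (A : set X) := forall e : R, 0 < e ->
  exists s : seq X, forall y, A y -> exists2 x, x \in s & mdist x y < e.

Lemma totally_bounded_sub X (A B : set X) :
  A `<=` B -> totally_bounded B -> totally_bounded A.
Proof. by move=> AB Btb e /Btb[s sB]; exists s => y /AB/sB. Qed.

Lemma compact_finite_cover X (A : set X) (f : X -> set X) :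
  compact A -> (forall x, A x -> nbhs x (f x)) ->
  exists s : seq X, (forall x, x \in s -> A x) /\
    forall y, A y -> exists2 x, x \in s & f x y.
Proof.
move=> Ac fn; apply: contrapT => nocover.
pose F : set_system X := fun B => exists s : seq X, (forall x, x \in s -> A x) /\
  forall y, A y -> (forall x, x \in s -> ~ f x y) -> B y.
have FF : ProperFilter F.
  split=> [[s [sA sB]]|].
    apply: nocover; exists s; split=> // y Ay.
    have [//|/forall2NP nf] := pselect (exists2 x, x \in s & f x y).
    by exfalso; apply: (sB y Ay) => x xs; case: (nf x).
  split=> [|B C [s [sA sB]] [t [tA tC]]|B C BC [s [sA sB]]].
  - by exists [::].
  - exists (s ++ t); split=> [x|y Ay st].
      by rewrite mem_cat => /orP[/sA|/tA].
    split; [apply: sB|apply: tC] => // x xs; apply: st;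
      by rewrite mem_cat xs ?orbT.
  - by exists s; split=> // y Ay ys; apply/BC/sB.
have [a [Aa aF]] : A `&` cluster F !=set0.
  by apply: Ac; exists [::]; split.
have [y [[Ay nf] fy]] : (A `\` f a) `&` f a !=set0.
  apply: aF; last exact: fn.
  exists [:: a]; split=> [x|y Ay ny]; first by rewrite inE => /eqP ->.
  by split=> //; apply: ny; rewrite inE.
by [].
Qed.

Lemma compact_totally_bounded X (A : set X) : compact A -> totally_bounded A.
Proof.
move=> Ac e e0; have [|s [_ sA]] := @compact_finite_cover X A (ball^~ e) Ac.
  by move=> x _; exact: nbhsx_ballx.
by exists s => y /sA[x xs]; rewrite ballEmdist; exists x.
Qed.

Lemma totally_bounded_compact X (A : set X) : complete_space X ->
  closed A -> totally_bounded A -> compact A.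
Proof.
move=> Xc Acl Atb; rewrite compact_ultra => F FU FA.
have [|x Fx] := Xc F _.
  apply: cauchy_exP => e e0; have [s sA] := Atb e e0; apply: contrapT.
  move=> /forallNP nF.
  have FC : F (\bigcap_(x in [set` s]) ~` ball x e).
    have -> : [set` s] = [set` [fset x in s]%fset].
      by apply/seteqP; split=> x /=; rewrite inE.
    apply: filter_bigI => x _.
    by have [/nF//|] := in_ultra_setVsetC (ball x e) FU.
  have [y [Ay yC]] := filter_ex (filterI FA FC).
  by have [x xs xy] := sA y Ay; apply: (yC x) => //; rewrite ballEmdist.
exists x; split=> //; apply: Acl => B xB.
exact: filter_ex (filterI FA (Fx _ xB)).
Qed.

Lemma closed_mdist_le X (r : X) (c : R) : closed [set x | mdist r x <= c].
Proof.
move=> x xc /=; apply/ler_addgt0Pl => e e0.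
have [y [/= yc]] := xc _ (nbhsx_ballx x e e0); rewrite ballEmdist/= => xy.
have := metric_triangle r y x; rewrite (metric_sym y x).
by move=> *; lra.
Qed.

Lemma seq_pos_lbound (I : eqType) (s : seq I) (f : I -> R) :
  (forall i, i \in s -> 0 < f i) ->
  exists2 d, 0 < d & forall i, i \in s -> d <= f i.
Proof.
elim: s => [|i s ih] sf; first by exists 1.
have [j js|d d0 ds] := ih; first by apply: sf; rewrite inE js orbT.
exists (Order.min d (f i)); first by rewrite lt_min d0 sf ?mem_head.
move=> j; rewrite inE ge_min => /orP[/eqP ->|/ds ->//].
by rewrite lexx orbT.
Qed.

(* Hopf-Rinow *)
Lemma closed_ball_compact X (r : X) (c : R) : geodesic_space X ->
  complete_space X -> locally_compact [set: X] ->
  compact [set x | mdist r x <= c].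
Proof.
move=> Xgeo Xc Xlc.
pose B c := [set x | mdist r x <= c].
have Bsub a b : a <= b -> B a `<=` B b by move=> ab x /le_trans; apply.
suff Btb : totally_bounded (B c).
  exact: totally_bounded_compact (@closed_mdist_le X r c) Btb.
pose S := [set a | 0 <= a /\ totally_bounded (B a)].
have S0 : S 0.
  split=> // e e0; exists [:: r] => y; rewrite /B/= => ry0.
  by exists r; [rewrite inE|rewrite (le_lt_trans ry0)].
apply: contrapT => Bc.
have Sub : has_ubound S.
  exists c => a [a0 Ba]; rewrite leNgt; apply/negP => /ltW ca; apply: Bc.
  exact: totally_bounded_sub (Bsub _ _ ca) Ba.
have hS : has_sup S by split=> //; exists 0.
pose m := sup S.
have m0 : 0 <= m by apply: ub_le_sup.
have Bm : compact (B m).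
  apply: totally_bounded_compact (@closed_mdist_le X r m) _ => // e e0.
  have e20 : 0 < e / 2 by lra.
  have [a [a0 Ba] ma] := sup_adherent e20 hS.
  have am : a <= m by apply: ub_le_sup.
  rewrite -/m in ma.
  have [s sB] := Ba _ e20; exists s => x; rewrite /B/= => rxm.
  have [rxa|rxa] := leP (mdist r x) a.
    by have [y ys yx] := sB x rxa; exists y => //; lra.
  have [f fx] := Xgeo r x.
  have arx : 0 <= a <= mdist r x by rewrite a0 ltW.
  have [|y ys yf] := sB (f a); first by rewrite /B/= (geodesic_source fx).
  exists y => //; have := geodesic_target fx arx.
  have := metric_triangle y (f a) x => *; lra.
have /(_ _)/cid2-/all_sig2[K Kn /all_and2[Kc Kcl]] : forall x : X,
    exists2 U, nbhs x U & compact U /\ closed U.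
  move=> x; have [//|U + UU] := Xlc x; rewrite withinET => xU.
  by exists U.
have /(_ _)/cid2-/all_sig2[e e0 eK] : forall x : X,
    exists2 e : R, 0 < e & ball x e `<=` K x.
  by move=> x; exact/nbhs_ballP/Kn.
have [|s [sB Bs]] := @compact_finite_cover X (B m) (fun x => ball x (e x / 2)) Bm.
  by move=> x _; apply: nbhsx_ballx; rewrite divr_gt0.
have [|d d0 ds] := @seq_pos_lbound _ s (fun x => e x / 2).
  by move=> x _; rewrite divr_gt0.
suff : m + d / 2 <= m by lra.
apply: ub_le_sup => //; split; first by lra.
apply: totally_bounded_sub (compact_totally_bounded
  (@bigsetU_compact _ _ K s xpredT (fun x _ => Kc x))) => y; rewrite /B/= => rym.
have [z Bz zy] : exists2 z, B m z & mdist z y < d.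
  have [rm|rm] := leP (mdist r y) m; first by exists y; rewrite ?mdistxx.
  have [f fy] := Xgeo r y.
  have mry : 0 <= m <= mdist r y by rewrite m0 ltW.
  exists (f m); first by rewrite /B/= (geodesic_source fy).
  by rewrite (geodesic_target fy); lra.
have [x xs] := Bs z Bz; rewrite ballEmdist/= => xz.
have -> : \big[setU/set0]_(i <- s) K i = \bigcup_(i in [set` s]) K i.
  by rewrite bigcup_seq.
exists x => //; apply: eK; rewrite ballEmdist/=.
by have := metric_triangle x z y; have := ds x xs => *; lra.
Qed.

End totally_bounded.

(** * Completion *)

Section completion.
Context {R : realType} (X : Type) (d : X -> X -> R).
Hypothesis dxx : forall x, d x x = 0.
Hypothesis dsym : forall x y, d x y = d y x.
Hypothesis dtri : forall x y z, d x z <= d x y + d y z.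

(* The functions [x |-> dist(p, x)] for [p] in the completion of [(X, d)]. *)
Definition dist_function (f : X -> R) :=
  [/\ forall x y, f x <= d x y + f y, forall x y, d x y <= f x + f y
    & forall e, 0 < e -> exists x, f x < e].

Definition rat_cuts (f : X -> R) (x : X) (q : rat) : Prop := f x < ratr q.

Lemma rat_cuts_inj : injective rat_cuts.
Proof.
have h f g : rat_cuts f = rat_cuts g -> forall x, f x <= g x.
  move=> fg x; rewrite leNgt; apply/negP => /rat_in_itvoo[q].
  rewrite in_itv/= => /andP[gq qf].
  have : rat_cuts f x q by rewrite fg.
  by rewrite /rat_cuts ltNge (ltW qf).
move=> f g fg; apply/funext => x; apply/eqP.
by rewrite eq_le !h.
Qed.

(* The points are coded by rational cuts, so that the carrier does not live in
   the universe of [R]. *)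
Definition completion_point :=
  {A : X -> rat -> Prop | exists f, dist_function f /\ A = rat_cuts f}.

Definition coord (p : completion_point) : X -> R := sval (cid (svalP p)).

Lemma coordP p : dist_function (coord p).
Proof. by rewrite /coord; case: cid => f []. Qed.

Lemma coord_inj : injective coord.
Proof.
move=> p q pq; have sE r : sval r = rat_cuts (coord r).
  by rewrite /coord; case: cid => f [].
have := sE p; have := sE q; rewrite pq; case: p q {pq sE} => [A hA] [B hB] /= <-.
by move=> AB; subst B; congr exist.
Qed.

Definition point_of (f : X -> R) (fd : dist_function f) : completion_point :=
  exist _ (rat_cuts f) (ex_intro _ f (conj fd erefl)).

Lemma point_ofK f (fd : dist_function f) : coord (point_of fd) = f.
Proof. by rewrite /coord; case: cid => g [_ /= /rat_cuts_inj]. Qed.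

Lemma coord_ge0 p x : 0 <= coord p x.
Proof. by have [_ /(_ x x) + _] := coordP p; rewrite dxx => *; lra. Qed.

Let sums (p q : completion_point) := range (fun x => coord p x + coord q x).

Definition cdist (p q : completion_point) : R := inf (sums p q).

Lemma cdist_le p q x : cdist p q <= coord p x + coord q x.
Proof.
apply: ge_inf; last by exists x.
by exists 0 => _ [y _ <-]; rewrite addr_ge0 ?coord_ge0.
Qed.

Lemma le_cdist p q a : (forall x, a <= coord p x + coord q x) -> a <= cdist p q.
Proof.
move=> apq; apply: lb_le_inf => [|_ [x _ <-]//].
by have [_ _ /(_ 1 ltr01)[x _]] := coordP p; exists (coord p x + coord q x), x.
Qed.

Lemma cdistxx p : cdist p p = 0.
Proof.
apply/eqP; rewrite eq_le; apply/andP; split; last first.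
  by apply: le_cdist => x; rewrite addr_ge0 ?coord_ge0.
apply/ler_addgt0Pl => e e0; rewrite addr0.
have [_ _ /(_ (e / 2))[|x px]] := coordP p; first by rewrite divr_gt0.
by have := cdist_le p p x => *; lra.
Qed.

Lemma cdist_coord p q x : coord p x <= cdist p q + coord q x.
Proof.
rewrite -lerBlDr; apply: le_cdist => y; rewrite lerBlDr.
have [/(_ x y) + _ _] := coordP p; have [_ /(_ x y) + _] := coordP q.
by move=> *; lra.
Qed.

Lemma cdistC p q : cdist p q = cdist q p.
Proof. by rewrite /cdist /sums; under eq_fun do rewrite addrC. Qed.

Lemma cdist0_eq p q : cdist p q = 0 -> p = q.
Proof.
move=> pq; apply/coord_inj/funext => x; apply/eqP; rewrite eq_le.
have := cdist_coord p q x; have := cdist_coord q p x.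
by rewrite (cdistC q) pq !add0r => -> ->.
Qed.

Lemma cdist_triangle q p r : cdist p r <= cdist p q + cdist q r.
Proof.
rewrite addrC -lerBlDr; apply: le_cdist => x.
have := cdist_le p r x; have := cdist_coord p q x => *; lra.
Qed.

Definition completion : metric_space R :=
  MetricSpace cdistxx cdist0_eq cdistC cdist_triangle.

Lemma dist_function_point x : dist_function (d x).
Proof.
split=> [y z|y z|e e0]; last by exists x; rewrite dxx.
- by rewrite addrC (dsym y).
- by rewrite (dsym x y).
Qed.

Definition to_completion (x : X) : completion := point_of (dist_function_point x).

Lemma mdist_to_completionr (p : completion) x :
  mdist p (to_completion x) = coord p x.
Proof.
apply/eqP; rewrite eq_le; apply/andP; split.
  by rewrite (le_trans (cdist_le _ _ x))// point_ofK dxx addr0.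
apply: le_cdist => y; rewrite point_ofK.
by have [/(_ x y) + _ _] := coordP p; rewrite addrC.
Qed.

Lemma mdist_to_completion x y :
  mdist (to_completion x) (to_completion y) = d x y.
Proof. by rewrite mdist_to_completionr point_ofK. Qed.

Lemma to_completion_dense (p : completion) e : 0 < e ->
  exists x, mdist p (to_completion x) < e.
Proof.
have [_ _ pinf] := coordP p; move=> /pinf[x px].
by exists x; rewrite mdist_to_completionr.
Qed.

Lemma completion_complete : complete_space completion.
Proof.
move=> F FF /cauchyP Fex.
have Fcvg x : exists l : R, coord p x @[p --> F] --> l.
  exists (lim (coord p x @[p --> F])).
  apply/cauchy_cvgP/cauchy_exP => e e0.
  have [p Fp] := Fex e e0; exists (coord p x); apply: (@filterS _ F _ _ _ _ Fp) => q.
  rewrite ballEmdist/= /ball/= => pq; apply: le_lt_trans pq.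
  rewrite ler_norml; have := cdist_coord p q x; have := cdist_coord q p x.
  by rewrite (cdistC q p) -[mdist p q]/(cdist p q) => *; apply/andP; split; lra.
pose f x := sval (cid (Fcvg x)).
have Ff x : coord p x @[p --> F] --> f x by rewrite /f; case: cid.
have fclose e p : 0 < e -> F (ball p e) ->
    forall x, coord p x <= f x + e /\ f x <= coord p x + e.
  move=> e0 Fp x.
  suff h e' : 0 < e' -> `|f x - coord p x| <= e + e'.
    have : `|f x - coord p x| <= e by apply/ler_addgt0Pr.
    by rewrite ler_norml => /andP[]; split; lra.
  move=> e'0; have /cvgrPdist_lt/(_ e' e'0) Fe' := Ff x.
  have [q [/= fq]] := filter_ex (filterI Fe' Fp); rewrite ballEmdist/= => pq.
  have := cdist_coord p q x; have := cdist_coord q p x.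
  rewrite (cdistC q p) -[mdist p q]/(cdist p q) in pq *.
  move: fq; rewrite ltr_norml => /andP[] *.
  by rewrite ler_norml; apply/andP; split; lra.
have fd : dist_function f.
  split=> [x y|x y|e e0].
  - apply/ler_addgt0Pl => e e0; have e40 : 0 < e / 4 by lra.
    have [p /(fclose _ _ e40) h] := Fex _ e40.
    have [/(_ x y) + _ _] := coordP p.
    by have [] := h x; have [] := h y => *; lra.
  - apply/ler_addgt0Pl => e e0; have e40 : 0 < e / 4 by lra.
    have [p /(fclose _ _ e40) h] := Fex _ e40.
    have [_ /(_ x y) + _] := coordP p.
    by have [] := h x; have [] := h y => *; lra.
  - have e40 : 0 < e / 4 by lra.
    have [p /(fclose _ _ e40) h] := Fex _ e40.
    have [_ _ /(_ _ e40)[x px]] := coordP p; exists x.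
    by have [] := h x => *; lra.
exists (point_of fd : completion) => B /nbhs_ballP[e /= e0 eB]; apply: (filterS eB).
have e40 : 0 < e / 4 by lra.
have [p Fp] := Fex _ e40; have h := fclose _ _ e40 Fp.
apply: filterS Fp => q; rewrite !ballEmdist/= => pq.
have [_ _ /(_ _ e40)[x px]] := coordP p; have [_ hx] := h x.
have := cdist_le (point_of fd) p x; rewrite point_ofK.
have := cdist_triangle p (point_of fd) q.
by rewrite -[mdist _ q]/(cdist _ q) -[mdist p q]/(cdist p q) in pq * => *; lra.
Qed.

End completion.


Section dense_subspace.
Context {R : realType} (M : metricType R) (X : Type) (i : X -> M).
Hypothesis idense : forall p e, 0 < e -> exists x, mdist p (i x) < e.

Lemma dense_four_point :
  (forall x y z w : X,
    mdist (i x) (i z) + mdist (i y) (i w) <=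
      mdist (i x) (i y) + mdist (i z) (i w) \/
    mdist (i x) (i z) + mdist (i y) (i w) <=
      mdist (i x) (i w) + mdist (i y) (i z)) -> four_point M.
Proof.
move=> X4 p q r s; apply: contrapT => /not_orP[].
move=> /negP; rewrite -ltNge => h1 /negP; rewrite -ltNge => h2.
pose e := Order.min
  (mdist p r + mdist q s - (mdist p q + mdist r s))
  (mdist p r + mdist q s - (mdist p s + mdist q r)) / 8.
have e0 : 0 < e by rewrite /e divr_gt0// lt_min !subr_gt0 h1.
have e1 : e * 8 <= mdist p r + mdist q s - (mdist p q + mdist r s).
  by rewrite /e divfK// ge_min lexx.
have e2 : e * 8 <= mdist p r + mdist q s - (mdist p s + mdist q r).
  by rewrite /e divfK// ge_min lexx orbT.
have [x px] := idense p e0; have [y qy] := idense q e0.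
have [z rz] := idense r e0; have [w sw] := idense s e0.
have le2 (a b a' b' : M) : mdist a a' < e -> mdist b b' < e ->
    `|mdist a b - mdist a' b'| < 2 * e.
  move=> aa bb; have := metric_triangle a a' b; have := metric_triangle a' b' b.
  have := metric_triangle a' a b'; have := metric_triangle a b b'.
  rewrite (metric_sym b' b) (metric_sym a' a) ltr_norml => *.
  by apply/andP; split; lra.
have := le2 _ _ _ _ px rz; have := le2 _ _ _ _ qy sw.
have := le2 _ _ _ _ px qy; have := le2 _ _ _ _ rz sw.
have := le2 _ _ _ _ px sw; have := le2 _ _ _ _ qy rz.
rewrite !ltr_norml => /andP[? ?] /andP[? ?] /andP[? ?] /andP[? ?] /andP[? ?].
by move=> /andP[? ?]; case: (X4 x y z w) => ?; lra.
Qed.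

Lemma between_geodesic (s t : M) : four_point M ->
  (forall u, 0 <= u <= mdist s t ->
    exists2 p, mdist s p = u & mdist p t = mdist s t - u) ->
  exists f, geodesic s t f.
Proof.
move=> M4 bst.
have /(_ _)/cid-/all_sig[f fP] : forall u, exists p, 0 <= u <= mdist s t ->
    mdist s p = u /\ mdist p t = mdist s t - u.
  move=> u; have [/bst[p]|] := boolP (0 <= u <= mdist s t); first by exists p.
  by exists s.
exists f; split=> [u v||].
- rewrite !in_itv/= => /fP[su ut] /fP[sv vt].
  have := @between_dist _ _ M4 s t (f u) (f v).
  rewrite /between su sv ut vt => /(_ ltac:(lra) ltac:(lra)) fuv.
  apply/eqP; rewrite eq_le fuv/= ler_norml.
  have := metric_triangle s (f u) (f v); have := metric_triangle s (f v) (f u).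
  by rewrite su sv (metric_sym (f v)) => *; apply/andP; split; lra.
- have [|+ _] := fP 0; first by rewrite lexx mdist_ge0.
  by move=> /mdist_positivity.
- have [|_ +] := fP (mdist s t); first by rewrite lexx mdist_ge0.
  by rewrite subrr => /mdist_positivity.
Qed.

Hypothesis Mcomplete : complete_space M.

(* Approximate intermediate points form a Cauchy filter by the four point
   condition. *)
Lemma dense_geodesic_space : four_point M ->
  (forall x y u, 0 <= u <= mdist (i x) (i y) -> exists2 z,
     mdist (i x) (i z) = u & mdist (i z) (i y) = mdist (i x) (i y) - u) ->
  geodesic_space M.
Proof.
move=> M4 Xgeo s t; apply: between_geodesic => // u /andP[u0 ust].
pose A e := [set p | mdist s p <= u + e /\ mdist p t <= mdist s t - u + e].
pose F : set_system M := fun B => exists2 e, 0 < e & A e `<=` B.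
have Ane e : 0 < e -> A e !=set0.
  move=> e0; have e40 : 0 < e / 4 by lra.
  have [x sx] := idense s e40; have [y ty] := idense t e40.
  pose v := Order.min u (mdist (i x) (i y)).
  have vu : v <= u by rewrite /v ge_min lexx.
  have vxy : v <= mdist (i x) (i y) by rewrite /v ge_min lexx orbT.
  have v0 : 0 <= v by rewrite /v le_min u0 mdist_ge0.
  have [|z xz zy] := Xgeo x y v; first by rewrite v0.
  exists (i z); split.
    by have := metric_triangle s (i x) (i z) => *; lra.
  have := metric_triangle (i z) (i y) t.
  have := metric_triangle (i x) s (i y); have := metric_triangle s t (i y).
  rewrite (metric_sym (i x) s) (metric_sym (i y) t).
  have [uxy|uxy] := leP u (mdist (i x) (i y)).
    have ev : v = u by rewrite /v; apply/min_idPl.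
    by rewrite ev in xz zy; move=> *; lra.
  have ev : v = mdist (i x) (i y) by rewrite /v; apply/min_idPr/ltW.
  by rewrite ev in zy; move=> *; lra.
have FF : ProperFilter F.
  split; first by move=> [e /Ane[p Ap] /(_ p Ap)].
  split; first by exists 1.
    move=> B C [e e0 eB] [e' e'0 eC]; exists (Order.min e e').
      by rewrite lt_min e0.
    have m1 : Order.min e e' <= e by rewrite ge_min lexx.
    have m2 : Order.min e e' <= e' by rewrite ge_min lexx orbT.
    by move=> p [? ?]; split; [apply: eB|apply: eC]; split; lra.
  by move=> B C BC [e e0 eB]; exists e => // p /eB/BC.
have [|p Fp] := Mcomplete FF.
  apply: cauchy_exP => e e0; have e80 : 0 < e / 8 by lra.
  have [p [sp pt]] := Ane _ e80; exists p; exists (e / 8) => // q [sq qt].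
  rewrite ballEmdist/=; case: (M4 p s q t).
    by rewrite (metric_sym p s) => *; lra.
  by move=> *; lra.
have near e : 0 < e -> exists2 q, A e q & mdist p q < e.
  move=> e0; have Fe : F (A e) by exists e.
  have [q [Aq]] := filter_ex (filterI Fe (Fp _ (nbhsx_ballx p e e0))).
  by rewrite ballEmdist/=; exists q.
have spu : mdist s p <= u.
  apply/ler_addgt0Pl => e e0; have e20 : 0 < e / 2 by lra.
  have [q [sq qt] pq] := near _ e20.
  by have := metric_triangle s q p; rewrite (metric_sym q p) => *; lra.
have ptu : mdist p t <= mdist s t - u.
  apply/ler_addgt0Pl => e e0; have e20 : 0 < e / 2 by lra.
  have [q [sq qt] pq] := near _ e20.
  by have := metric_triangle p q t => *; lra.
by exists p; have := metric_triangle s p t => *; lra.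
Qed.

End dense_subspace.

(** * The Gromov-Hausdorff type distance *)

Section coupling.
Context {R : realType}.
Implicit Types X : metricType R.

(* [c x y] plays the part of the distance between [x] and [y] in a metric on
   the disjoint union that extends those of [X1] and [X2]. *)
Definition cross_dist X1 X2 (c : X1 -> X2 -> R) :=
  [/\ forall x x' y, c x y <= mdist x x' + c x' y,
      forall x y y', c x y <= c x y' + mdist y' y,
      forall x x' y, mdist x x' <= c x y + c x' y
    & forall x y y', mdist y y' <= c x y + c x y'].

Definition coupling X1 X2 (r1 : X1) (r2 : X2) (e : R) (c : X1 -> X2 -> R) :=
  cross_dist c /\
  [/\ forall x, exists y, c x y < e, forall y, exists x, c x y < e
    & c r1 r2 < e].

Section glued.
Variables (X1 X2 : metricType R) (c : X1 -> X2 -> R).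

Definition glued (cc : cross_dist c) (c0 : forall x y, 0 < c x y) : Type :=
  (X1 + X2)%type.

Variables (cc : cross_dist c) (c0 : forall x y, 0 < c x y).

HB.instance Definition _ := gen_eqMixin (glued cc c0).
HB.instance Definition _ := gen_choiceMixin (glued cc c0).

Let gdist (p q : glued cc c0) : R :=
  match p, q with
  | inl x, inl x' => mdist x x'
  | inr y, inr y' => mdist y y'
  | inl x, inr y => c x y
  | inr y, inl x => c x y
  end.

Let gdistxx p : gdist p p = 0.
Proof. by case: p => x /=; rewrite mdistxx. Qed.

Let gdist_pos p q : gdist p q = 0 -> p = q.
Proof.
case: p q => [x|y] [x'|y'] /=; try by move=> /mdist_positivity ->.
- by move=> h; have := c0 x y'; rewrite h ltxx.
- by move=> h; have := c0 x' y; rewrite h ltxx.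
Qed.

Let gdist_sym p q : gdist p q = gdist q p.
Proof. by case: p q => [x|y] [x'|y'] //=; exact: metric_sym. Qed.

Let gdist_triangle q p s : gdist p s <= gdist p q + gdist q s.
Proof.
have [c1 c2 c3 c4] := cc.
case: p q s => [x|y] [x'|y'] [x2|y2] //=; try exact: metric_triangle.
- by rewrite addrC (metric_sym x').
- by rewrite addrC (metric_sym y).
Qed.

HB.instance Definition _ := isMetric.Build R (glued cc c0)
  gdistxx gdist_pos gdist_sym gdist_triangle.
End glued.

Lemma coupling_delta_cpct X1 X2 (r1 : X1) (r2 : X2) (e : R) c :
  coupling r1 r2 e c -> (delta_cpct r1 r2 <= e%:E)%E.
Proof.
move=> [[c1 c2 c3 c4] [c12 c21 cr]]; apply/lee_addgt0Pr => h h0.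
have c0 x y : 0 <= c x y by have := c3 x x y; rewrite mdistxx => *; lra.
pose c' x y := c x y + h / 2.
have cc : cross_dist c'.
  split=> [x x' y|x y y'|x x' y|x y y']; rewrite /c'.
  - by have := c1 x x' y => *; lra.
  - by have := c2 x y y' => *; lra.
  - by have := c3 x x' y => *; lra.
  - by have := c4 x y y' => *; lra.
have c'0 x y : 0 < c' x y by rewrite /c'; have := c0 x y => *; lra.
pose E : metricType R := glued cc c'0.
have eh : 0 < e + h by have := c0 r1 r2 => *; lra.
apply: le_trans (_ : maxe (hausdorff_dist (range (inl : X1 -> E))
  (range (inr : X2 -> E))) (mdist (inl r1 : E) (inr r2))%:E <= _)%E.
  by apply: ereal_inf_lbound; exists E, inl, inr; split.
rewrite ge_max -EFinD lee_fin; apply/andP; split.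
  apply: ereal_inf_lbound; exists (e + h) => //; split=> //.
    move=> _ [x _ <-]; have [y xy] := c12 x; exists (inr y : E); first by exists y.
    by rewrite ballEmdist /mdist/= /c'; lra.
  move=> _ [y _ <-]; have [x xy] := c21 y; exists (inl x : E); first by exists x.
  by rewrite ballEmdist /mdist/= /c'; lra.
by rewrite /mdist/= /c'; lra.
Qed.

Lemma delta_cpct_coupling X1 X2 (r1 : X1) (r2 : X2) (e : R) :
  (delta_cpct r1 r2 < e%:E)%E -> exists c, coupling r1 r2 e c.
Proof.
move=> /ereal_inf_lt[_ [E [f1 [f2 [i1 i2 ->]]]]].
rewrite gt_max lte_fin => /andP[/ereal_inf_lt[_ [e' [e'0 h12 h21] <-]]].
rewrite lte_fin => e'e r12; exists (fun x y => mdist (f1 x) (f2 y)); split.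
  split=> [x x' y|x y y'|x x' y|x y y'].
  - by rewrite -i1; exact: metric_triangle.
  - by rewrite -i2; exact: metric_triangle.
  - by rewrite -i1 (metric_sym (f1 x')); exact: metric_triangle.
  - by rewrite -i2 (metric_sym (f1 x)); exact: metric_triangle.
split=> [x|y|//].
- have [|_ [y _ <-]] := h12 (f1 x); first by exists x.
  by rewrite ballEmdist/= metric_sym => /lt_trans yx; exists y; exact: yx.
- have [|_ [x _ <-]] := h21 (f2 y); first by exists y.
  by rewrite ballEmdist/= => /lt_trans yx; exists x; exact: yx.
Qed.

Lemma delta_cpct_ge0 X1 X2 (r1 : X1) (r2 : X2) : (0 <= delta_cpct r1 r2)%E.
Proof.
apply: le_ereal_inf_tmp => _ [E [f1 [f2 [i1 i2 ->]]]].
by rewrite le_max lee_fin mdist_ge0 orbT.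
Qed.

Lemma le_delta_cpct_coupling X1 X2 (r1 : X1) (r2 : X2) (x : \bar R) :
  (0 <= x)%E ->
  (forall e, (x < e%:E)%E -> exists c, coupling r1 r2 e c) ->
  (delta_cpct r1 r2 <= x)%E.
Proof.
case: x => [x _ h|_ _|//]; last exact: leey.
apply/lee_addgt0Pr => e e0; have [|c cP] := h (x + e).
  by rewrite lte_fin; lra.
exact: coupling_delta_cpct cP.
Qed.

Lemma delta_cpct_sym X1 X2 (r1 : X1) (r2 : X2) :
  delta_cpct r1 r2 = delta_cpct r2 r1.
Proof.
have h (Y1 Y2 : metricType R) (s1 : Y1) (s2 : Y2) :
    (delta_cpct s1 s2 <= delta_cpct s2 s1)%E.
  apply: le_delta_cpct_coupling; first exact: delta_cpct_ge0.
  move=> e /delta_cpct_coupling[c [[c1 c2 c3 c4] [c12 c21 cr]]].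
  exists (fun x y => c y x); split; split=> // x y z.
  - by rewrite addrC metric_sym.
  - by rewrite addrC metric_sym.
by apply/eqP; rewrite eq_le !h.
Qed.

Lemma coupling_comp X1 X2 X3 (r1 : X1) (r2 : X2) (r3 : X3) a b c c' :
  coupling r1 r2 a c -> coupling r2 r3 b c' ->
  exists c2, coupling r1 r3 (a + b) c2.
Proof.
move=> [[c1 c2 c3 c4] [c12 c21 cr]] [[d1 d2 d3 d4] [d12 d21 dr]].
have c0 x y : 0 <= c x y by have := c3 x x y; rewrite mdistxx => *; lra.
have d0 x y : 0 <= c' x y by have := d3 x x y; rewrite mdistxx => *; lra.
pose g x z := inf [set c x y + c' y z | y in [set: X2]].
have gle x y z : g x z <= c x y + c' y z.
  by apply: ge_inf; [exists 0 => _ [t _ <-]; rewrite addr_ge0|exists y].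
have leg x z u : (forall y, u <= c x y + c' y z) -> u <= g x z.
  move=> h; apply: lb_le_inf => [|_ [y _ <-]//].
  by exists (c x r2 + c' r2 z), r2.
exists g; split; split.
- move=> x x' y; rewrite addrC -lerBlDr; apply: leg => z.
  by have := gle x z y; have := c1 x x' z => *; lra.
- move=> x y y'; rewrite -lerBlDr; apply: leg => z.
  by have := gle x z y; have := d2 z y y' => *; lra.
- move=> x x' y; rewrite -lerBlDr; apply/leg => z; rewrite lerBlDr addrC -lerBlDr.
  apply: leg => z'.
  have := c3 x x' z; have := c1 x' x z; have := c2 x' z z'.
  by have := d3 z z' y; rewrite (metric_sym z') => *; lra.
- move=> x y y'; rewrite -lerBlDr; apply/leg => z; rewrite lerBlDr addrC -lerBlDr.
  apply: leg => z'.
  have := d4 z y y'; have := c4 x z z'.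
  by have := d1 z z' y' => *; lra.
- move=> x; have [y xy] := c12 x; have [z yz] := d12 y; exists z.
  by have := gle x y z => *; lra.
- move=> z; have [y yz] := d21 z; have [x xy] := c21 y; exists x.
  by have := gle x y z => *; lra.
- by have := gle r1 r2 r3 => *; lra.
Qed.

Lemma delta_cpct_triangle X1 X2 X3 (r1 : X1) (r2 : X2) (r3 : X3) :
  (delta_cpct r1 r3 <= delta_cpct r1 r2 + delta_cpct r2 r3)%E.
Proof.
have := delta_cpct_ge0 r1 r2; have := delta_cpct_ge0 r2 r3.
case e12 : (delta_cpct r1 r2) => [a| |]; case e23 : (delta_cpct r2 r3) => [b| |];
  rewrite ?leey// => b0 a0.
apply/lee_addgt0Pr => e e0; have e20 : 0 < e / 2 by lra.
have [c cP] : exists c, coupling r1 r2 (a + e / 2) c.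
  by apply: delta_cpct_coupling; rewrite e12 lte_fin; lra.
have [c' c'P] : exists c, coupling r2 r3 (b + e / 2) c.
  by apply: delta_cpct_coupling; rewrite e23 lte_fin; lra.
have [c2 /coupling_delta_cpct] := coupling_comp cP c'P.
by move=> /le_trans; apply; rewrite lee_fin; lra.
Qed.

End coupling.

Section delta_metric.
Context {R : realType}.
Implicit Types T : clcr_tree R.

Let term_ge0 T1 T2 k :
  (0 <= (2^-1 ^+ k)%:E * delta_cpct (ball_root (root T1) k) (ball_root (root T2) k))%E.
Proof. by rewrite mule_ge0 ?delta_cpct_ge0// lee_fin exprn_ge0. Qed.

Lemma tree_dist_ge0 T1 T2 : (0 <= tree_dist T1 T2)%E.
Proof. by apply: nneseries_ge0 => k _ _; exact: term_ge0. Qed.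

Lemma tree_dist_sym T1 T2 : tree_dist T1 T2 = tree_dist T2 T1.
Proof. by apply: eq_eseriesr => k _; rewrite delta_cpct_sym. Qed.

Lemma tree_dist_triangle T1 T2 T3 :
  (tree_dist T1 T3 <= tree_dist T1 T2 + tree_dist T2 T3)%E.
Proof.
rewrite -nneseriesD; [|by move=> k _ _; exact: term_ge0..].
apply: lee_nneseries => [k _ _|k _]; first exact: term_ge0.
rewrite -ge0_muleDr ?delta_cpct_ge0//.
by rewrite lee_wpmul2l ?delta_cpct_triangle// lee_fin exprn_ge0.
Qed.

Lemma tree_dist_coupling T1 T2 (k : nat) (e : R) : (0 < k)%N ->
  (tree_dist T1 T2 < (2^-1 ^+ k * e)%:E)%E ->
  exists c, coupling (ball_root (root T1) k) (ball_root (root T2) k) e c.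
Proof.
move=> k0 T12; apply: delta_cpct_coupling.
have k20 : 0 < 2^-1 ^+ k :> R by rewrite exprn_gt0 ?invr_gt0.
rewrite -(@lte_pmul2l _ (2^-1 ^+ k)%:E) ?lte_fin//.
apply: le_lt_trans T12.
have := @nneseries_lim_ge R _ xpredT 1 k.+1
   (fun j _ _ => @term_ge0 T1 T2 j).
apply: le_trans; rewrite big_nat_recr//= leeDr//.
by apply: sume_ge0 => j _; exact: term_ge0.
Qed.

Lemma delta_ge0 (t1 t2 : tree_class R) : (0 <= delta t1 t2)%E.
Proof. exact: tree_dist_ge0. Qed.

Lemma delta_sym (t1 t2 : tree_class R) : delta t1 t2 = delta t2 t1.
Proof. exact: tree_dist_sym. Qed.

Lemma delta_triangle (t1 t2 t3 : tree_class R) :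
  (delta t1 t3 <= delta t1 t2 + delta t2 t3)%E.
Proof. exact: tree_dist_triangle. Qed.

End delta_metric.

(** * The counts [Z] *)

Lemma compact_lipschitz_min {R : realType} (X : metricType R) (A : set X)
    (f : X -> R) (L : R) : 0 < L -> A !=set0 -> compact A ->
  (forall x y, `|f x - f y| <= L * mdist x y) ->
  exists2 c, A c & forall t, A t -> f c <= f t.
Proof.
move=> L0 A0 Ac fL; have [||//|c cA cf] := @compact_EVT_min X R f A.
- exact: A0.
- exact: Ac.
- apply: continuous_subspaceT => x; apply/cvgrPdist_lt => e e0.
  apply/nbhs_ballP; exists (e / L); first exact: divr_gt0.
  move=> z; rewrite ballEmdist/= ltr_pdivlMr// mulrC.
  exact: le_lt_trans.
- by exists c; [exact: set_mem|move=> t /mem_set/cf].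
Qed.

Section tree_facts.
Context {R : realType}.
Implicit Types T : clcr_tree R.

Lemma tree_four_point T : four_point T.
Proof. exact: real_tree_four_point (clcr_real_tree T). Qed.

Lemma tree_geodesic T : geodesic_space T.
Proof. by move=> s t; have [f fst _] := (clcr_real_tree T).1 s t; exists f. Qed.

Lemma tree_closed_ball_compact T (c : R) :
  compact [set x : T | mdist (root T) x <= c].
Proof.
apply: closed_ball_compact; [exact: tree_geodesic|exact: clcr_complete|].
exact: clcr_locally_compact.
Qed.

Lemma between_point T (s t : T) u : 0 <= u <= mdist s t ->
  exists2 p, between s t p & mdist s p = u.
Proof.
move=> ust; have [f fst] := @tree_geodesic T s t; exists (f u).
  exact: geodesic_between fst ust.
exact: geodesic_source fst ust.
Qed.

Definition Zset (h a : R) T := [set s : T | trim h s /\ mdist (root T) s = a].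
Arguments Zset h a T : clear implicits.

Lemma ZsetP (h a : R) T (s : T) : 0 < a -> 0 <= h -> Zset h a T s <->
  mdist (root T) s = a /\ exists2 y, between (root T) y s & mdist s y = h.
Proof.
move=> a0 h0; split=> [[sR sa]|[sa [y ys yh]]]; last first.
  split=> //; right; exists y; rewrite yh lexx; split=> //.
  exact/(segmentE (@tree_four_point T) (@tree_geodesic T)).
split=> //; case: sR => [s_root|[y [/segment_between ys hy]]].
  by move: sa; rewrite s_root mdistxx => a00; rewrite -a00 ltxx in a0.
have [|z syz sz] := @between_point T s y h; first by rewrite h0.
exists z => //; move: ys syz; rewrite /between.
have := metric_triangle (root T) s z; have := metric_triangle (root T) z y.
by move=> *; lra.
Qed.

Lemma ancestor_eq T (a h : R) (s1 s2 y1 y2 : T) :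
  mdist (root T) s1 = a -> mdist (root T) s2 = a ->
  between (root T) y1 s1 -> between (root T) y2 s2 ->
  mdist s1 y1 = h -> mdist s2 y2 = h -> mdist y1 y2 <= 2 * h -> s1 = s2.
Proof.
move=> r1 r2 b1 b2 h1 h2 yh; have s4 := @tree_four_point T.
apply: (between_eq s4 b1); last by rewrite r1.
move: b1 b2 (s4 y1 y2 s2 (root T)) (metric_triangle (root T) s2 y1).
rewrite /between (metric_sym y1 s2) (metric_sym y2 (root T)).
rewrite (metric_sym s2 (root T)) (metric_sym y2 s2) (metric_sym y1 (root T)).
by move=> ? ? [] *; lra.
Qed.

Lemma Zset_finite (h a : R) T : 0 < a -> 0 < h -> finite_set (Zset h a T).
Proof.
move=> a0 h0; have h0' := ltW h0.
have [s sB] := compact_totally_bounded (@tree_closed_ball_compact T (a + h)) h0.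
pose close x z := Zset h a T z /\ exists y,
  [/\ between (root T) y z, mdist z y = h & mdist x y < h].
have close_eq x z z' : close x z -> close x z' -> z = z'.
  move=> [/(ZsetP _ a0 h0')[za _] [y [by_ zy xy]]].
  move=> [/(ZsetP _ a0 h0')[z'a _] [y' [by' z'y xy']]].
  apply: (ancestor_eq za z'a by_ by' zy z'y).
  by have := metric_triangle y x y'; rewrite (metric_sym y x) => *; lra.
have /(_ _)/cid-/all_sig[g gP] :
    forall x : T, exists z, forall z', close x z' -> z' = z.
  move=> x; have [[z xz]|nx] := pselect (exists z, close x z).
    by exists z => z' xz'; exact: close_eq xz' xz.
  by exists x => z' xz'; exfalso; apply: nx; exists z'.
apply: (@sub_finite_set _ _ (g @` [set` s])); last first.
  exact/finite_image/finite_seq.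
move=> z Zz; have [za [y yz zy]] := (ZsetP z a0 h0').1 Zz.
have [|x xs xy] := sB y; first by move: yz; rewrite /between/= => *; lra.
by exists x => //; apply/esym/gP; split=> //; exists y.
Qed.

(* The branching points of the [x i] lie below height [a], hence the [x i] have
   distinct ancestors at height [a]. All inequalities are strict, so that the
   condition is open in [T]. *)
Definition spread (m : nat) (a b : R) T := exists x : 'I_m -> T,
  (forall i, a + b < mdist (root T) (x i)) /\
  (forall i j, i != j -> mdist (root T) (x i) + mdist (root T) (x j) <
     mdist (x i) (x j) + 2 * a).

Lemma card_fset_setP (T : choiceType) (A : set T) m (t0 : T) : finite_set A ->
  (m <= #|` fset_set A|%fset)%N <->
  exists s : 'I_m -> T, injective s /\ forall i, A (s i).
Proof.
move=> Afin; split=> [mA|[s [sinj sA]]].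
  have sz (i : 'I_m) : (i < size (fset_set A))%N by exact: leq_trans mA.
  exists (fun i : 'I_m => nth t0 (fset_set A) i); split=> [i j /eqP|i].
    by rewrite nth_uniq// => /eqP/val_inj.
  have : nth t0 (fset_set A) i \in fset_set A by exact: mem_nth.
  by rewrite in_fset_set// inE.
rewrite -[m]card_ord -(size_codom s).
apply: uniq_leq_size; first by rewrite map_inj_uniq ?enum_uniq.
by move=> _ /codomP[i ->]; rewrite in_fset_set// inE.
Qed.

Lemma tree_Z_spread (m : nat) (h a b : R) T : 0 < a -> 0 <= b -> b < h ->
  (m <= tree_Z h a T)%N -> spread m a b T.
Proof.
move=> a0 b0 bh; have h0 : 0 < h by lra.
move=> /(card_fset_setP _ (root T) (@Zset_finite h a T a0 h0))[s [sinj sZ]].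
have /all_and2[sa /(_ _)/cid2-/all_sig2[y ys sy]] := fun i =>
  (ZsetP (s i) a0 (ltW h0)).1 (sZ i).
have ry i : mdist (root T) (y i) = a + h by rewrite -(ys i) sa sy.
exists y; split=> [i|i j ij]; first by rewrite ry; lra.
rewrite !ry ltNge; apply: contra ij => yy; apply/eqP/sinj.
by apply: (ancestor_eq (sa i) (sa j) (ys i) (ys j) (sy i) (sy j)); lra.
Qed.

Lemma spread_tree_Z (m : nat) (a b : R) T : 0 < a -> 0 < b ->
  spread m a b T -> (m <= tree_Z b a T)%N.
Proof.
move=> a0 b0 [x [xb xx]].
have /(_ _)/cid2-/all_sig2[s sx sa] : forall i, exists2 s,
    between (root T) (x i) s & mdist (root T) s = a.
  by move=> i; apply: between_point; have := xb i => *; lra.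
apply/(card_fset_setP _ (root T) (@Zset_finite b a T a0 b0)).
exists s; split=> [i j sij|i].
  apply/eqP/negPn/negP => /xx; have := sx i; have := sx j; have := sa j.
  have := metric_triangle (x i) (s j) (x j); have := metric_sym (x i) (s j).
  by rewrite /between sij => *; lra.
split=> //; right; exists (x i); split.
  exact/(segmentE (@tree_four_point T) (@tree_geodesic T)).
by have := sx i; have := xb i; rewrite /between sa => *; lra.
Qed.

Lemma Zset_anti (h h' a : R) T : h' <= h -> Zset h a T `<=` Zset h' a T.
Proof.
move=> hh s [[->|[y [sy hy]]] sa]; split=> //; first by left.
by right; exists y; split=> //; exact: le_trans hy.
Qed.

Definition below (h : R) (k : nat) : R := h - h / k.+2%:R.

Lemma below_lt (h : R) k : 0 < h -> 0 < below h k < h.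
Proof.
move=> h0; rewrite /below gtrBl divr_gt0//= subr_gt0 andbT.
by rewrite ltr_pdivrMr// ltr_pMr// ltr1n.
Qed.

Lemma below_le (h : R) j k : 0 < h -> (j <= k)%N -> below h j <= below h k.
Proof.
by move=> h0 jk; rewrite /below lerB// ler_pM2l// lef_pV2 ?posrE// ler_nat.
Qed.

Lemma below_cvg (h e : R) : 0 < h -> 0 < e -> exists k, h - below h k < e.
Proof.
move=> h0 e0; exists (Num.bound (h / e)); rewrite /below opprB addrC subrK.
have hb : h / e < (Num.bound (h / e))%:R.
  by apply: archi_boundP; rewrite divr_ge0 ?ltW.
rewrite ltr_pdivrMr// mulrC -ltr_pdivrMr//; apply: lt_le_trans hb _.
by rewrite ler_nat; apply/leqW/leqW.
Qed.

Lemma Zset_below (h a : R) T (s : T) : 0 < a -> 0 < h ->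
  (forall k, Zset (below h k) a T s) -> Zset h a T s.
Proof.
move=> a0 h0 sZ.
have sa : mdist (root T) s = a by case: (sZ 0).
pose f (y : T) := a + mdist s y + (a + h) - 2 * mdist (root T) y.
have fL x y : `|f x - f y| <= 3 * mdist x y.
  have := metric_triangle s x y; have := metric_triangle s y x.
  have := metric_triangle (root T) x y; have := metric_triangle (root T) y x.
  by rewrite (metric_sym y x) ler_norml /f => *; apply/andP; split; lra.
pose B := [set y : T | mdist (root T) y <= a + h].
have [|||y By yP] := compact_lipschitz_min _ _ _ fL (A := B).
- by [].
- by exists s; rewrite /B/= sa; lra.
- exact: tree_closed_ball_compact.
have fy0 : f y <= 0.
  apply/ler_addgt0Pl => e e0; have [k ke] := below_cvg h0 e0.
  have /andP[bk0 bkh] := below_lt k h0.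
  have [_ [z zs sz]] := (ZsetP s a0 (ltW bk0)).1 (sZ k).
  have rz : mdist (root T) z = a + below h k by rewrite -zs sa sz.
  rewrite addr0; apply: le_trans (yP z _) _.
    by rewrite /B/= rz; lra.
  by rewrite /f rz sz; lra.
apply/(ZsetP s a0 (ltW h0)); split=> //; exists y.
all: move: By fy0; rewrite /B /f /between/=.
all: by have := metric_triangle (root T) s y => *; lra.
Qed.

(* Compactness is needed to reach [h] from below: the finite sets
   [Zset (below h k) a T] decrease with [k], so they are eventually constant. *)
Lemma tree_Z_geP (m : nat) (h a : R) T : 0 < a -> 0 < h ->
  (m <= tree_Z h a T)%N <-> forall k, spread m a (below h k) T.
Proof.
move=> a0 h0; split=> [mZ k|mZ].
  by have /andP[bk0 bkh] := below_lt k h0; exact: tree_Z_spread (ltW bk0) bkh mZ.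
pose c k := tree_Z (below h k) a T.
have bfin k : finite_set (Zset (below h k) a T).
  by have /andP[bk0 _] := below_lt k h0; exact: Zset_finite.
have mc k : (m <= c k)%N.
  by have /andP[bk0 _] := below_lt k h0; exact: spread_tree_Z.
have [n [k0 ck0] nmin] : exists2 n, exists k, c k = n &
    forall k, (n <= c k)%N.
  have exn : exists n, `[< exists k, c k = n >].
    by exists (c 0%N); apply/asboolP; exists 0%N.
  case: (ex_minnP exn) => n /asboolP nk nmin; exists n => // k.
  by apply: nmin; apply/asboolP; exists k.
apply: leq_trans (mc k0) _; rewrite /c /tree_Z.
rewrite -/(Zset _ _ T) -/(Zset _ _ T).
apply: fsubset_leq_card; rewrite -fset_set_sub//; last exact: Zset_finite.
move=> s sk0; apply: Zset_below => // k.
have [kk0|/ltnW k0k] := leqP k k0.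
  by apply: Zset_anti sk0; exact: below_le.
have sub : Zset (below h k) a T `<=` Zset (below h k0) a T.
  by apply: Zset_anti; exact: below_le.
suff E : fset_set (Zset (below h k) a T) = fset_set (Zset (below h k0) a T).
  by rewrite -(fset_setK (bfin k)) E fset_setK.
apply/eqP; rewrite eqEfcard; apply/andP; split; first by rewrite -fset_set_sub.
by have := nmin k; rewrite -ck0.
Qed.

Lemma tree_Z_embedding (h a : R) T1 T2 (f : T1 -> T2) : 0 < a -> 0 < h ->
  isometric_embedding f -> f (root T1) = root T2 ->
  (tree_Z h a T1 <= tree_Z h a T2)%N.
Proof.
move=> a0 h0 fi fr; apply/(tree_Z_geP _ _ a0 h0) => k.
have /(tree_Z_geP _ _ a0 h0)/(_ k)[x [xb xx]] := leqnn (tree_Z h a T1).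
by exists (f \o x); split=> [i|i j ij] /=; rewrite -fr !fi; [exact: xb|exact: xx].
Qed.

End tree_facts.
Arguments Zset {R} h a T.

Section spread_measurable.
Context {R : realType}.

Lemma spread_delta_open (m : nat) (a b : R) :
  delta_open [set t : tree_class R | spread m a b (repr t)].
Proof.
move=> t [x [xb xx]]; set r := root (repr t) in xb xx.
have [|d1 d10 d1P] := @seq_pos_lbound R _ (enum 'I_m)
    (fun i => mdist r (x i) - (a + b)).
  by move=> i _; rewrite subr_gt0.
have [|d2 d20 d2P] := @seq_pos_lbound R _ [seq p <- enum {: 'I_m * 'I_m} | p.1 != p.2]
    (fun p => mdist (x p.1) (x p.2) + 2 * a -
       (mdist r (x p.1) + mdist r (x p.2))).
  by move=> [i j]; rewrite mem_filter /= => /andP[ij _]; rewrite subr_gt0 xx.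
pose K := (\max_(i < m) Num.bound (mdist r (x i))).+1.
have xK i : mdist r (x i) <= K%:R.
  apply/ltW; apply: lt_le_trans (archi_boundP (mdist_ge0 _ _)) _.
  rewrite ler_nat; apply: leqW.
  exact: (leq_bigmax (F := fun i : 'I_m => Num.bound (mdist r (x i))) i).
pose e := Order.min d1 d2 / 8.
have e0 : 0 < e by rewrite /e divr_gt0// lt_min d10.
have e1 : 8 * e <= d1 by rewrite /e mulrC divfK// ge_min lexx.
have e2 : 8 * e <= d2 by rewrite /e mulrC divfK// ge_min lexx orbT.
exists (2^-1 ^+ K * e); first by rewrite mulr_gt0 ?exprn_gt0 ?invr_gt0.
move=> t' tt'; have [c [[c1 c2 c3 c4] [c12 _ cr]]] := tree_dist_coupling (ltn0Sn _) tt'.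
pose x' i : ball_space r K%:R := exist _ (x i) (xK i).
have /(_ _)/cid-/all_sig[y yP] := fun i => c12 (x' i).
have rE i : mdist (ball_root r K) (x' i) = mdist r (x i) by [].
have xE i j : mdist (x' i) (x' j) = mdist (x i) (x j) by [].
have ryl i : mdist r (x i) - 2 * e <= mdist (ball_root (root (repr t')) K) (y i).
  have := c3 (ball_root r K) (x' i) (y i); rewrite rE.
  have := c2 (ball_root r K) (y i) (ball_root (root (repr t')) K).
  by have := yP i => *; lra.
have ryu i : mdist (ball_root (root (repr t')) K) (y i) <= mdist r (x i) + 2 * e.
  have := c4 (ball_root r K) (ball_root (root (repr t')) K) (y i).
  have := c1 (ball_root r K) (x' i) (y i); rewrite rE.
  by have := yP i => *; lra.
have xyl i j : mdist (x i) (x j) - 2 * e <= mdist (y i) (y j).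
  have := c3 (x' i) (x' j) (y i); rewrite xE.
  by have := c2 (x' j) (y i) (y j); rewrite (metric_sym (y j));
    have := yP i; have := yP j => *; lra.
exists (fun i => val (y i)); split=> [i|i j ij].
  have := d1P i (mem_enum _ _); have := ryl i.
  by rewrite -[mdist (root _) _]/(mdist (ball_root (root (repr t')) K) (y i)) => *; lra.
have := d2P (i, j); rewrite mem_filter/= ij mem_enum => /(_ isT).
have := ryu i; have := ryu j; have := xyl i j.
rewrite -[mdist (root _) (val (y i))]/(mdist (ball_root (root (repr t')) K) (y i)).
rewrite -[mdist (root _) (val (y j))]/(mdist (ball_root (root (repr t')) K) (y j)).
by rewrite -[mdist (val _) _]/(mdist (y i) (y j)) => *; lra.
Qed.

Lemma measurable_delta_open (U : set (tree_class R)) :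
  delta_open U -> measurable (U : set (borel_tree R)).
Proof. exact: sub_sigma_algebra. Qed.

Lemma measurable_Z_ge (m : nat) (a h : R) : 0 < a -> 0 < h ->
  measurable [set t : borel_tree R | (m <= Z h a (t : tree_class R))%N].
Proof.
move=> a0 h0; rewrite (_ : [set _ | _] = \bigcap_k
    [set t : tree_class R | spread m a (below h k) (repr t)]).
  apply: bigcap_measurable; first by exists 0%N.
  move=> k _; apply: measurable_delta_open; exact: spread_delta_open.
apply/seteqP; split=> t /=.
  by move=> /(tree_Z_geP _ _ a0 h0) mZ k _; exact: mZ.
by move=> mZ; apply/(tree_Z_geP _ _ a0 h0) => k; exact: mZ.
Qed.

End spread_measurable.

Lemma ereal_cvg0P {R : realType} (u : nat -> \bar R) : (forall n, (0 <= u n)%E) ->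
  (u n @[n --> \oo] --> 0%E) <->
  (forall e : R, 0 < e -> exists N, forall n, (N <= n)%N -> (u n < e%:E)%E).
Proof.
move=> u0; split=> [/fine_cvgP[ufin ucvg] e e0|uP].
  have /cvgrPdist_lt/(_ e e0) ue := ucvg.
  have [N _ NP] := filterI ufin ue; exists N => n /NP[/= un].
  rewrite sub0r normrN ger0_norm ?fine_ge0// => une.
  by rewrite -(fineK un) lte_fin.
apply/fine_cvgP; split.
  have [N NP] := uP 1 ltr01; exists N => // n /= /NP un.
  by rewrite ge0_fin_numE// (lt_trans un)// ltry.
apply/cvgrPdist_lt => e e0; have [N NP] := uP e e0; exists N => // n /= /NP un.
have ufin : u n \is a fin_num by rewrite ge0_fin_numE// (lt_trans un)// ltry.
by rewrite sub0r normrN ger0_norm ?fine_ge0// -lte_fin fineK.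
Qed.

Section limit_measurable.
Context {R : realType}.

(* [T w] lies in the open set [U] iff, for some [k], eventually all [T_n w] lie
   in the open set of the points at distance more than [1/k] from [~` U]. *)
Lemma measurable_delta_limit d (Omega : measurableType d)
    (D : set Omega) (T : nat -> Omega -> borel_tree R) (L : Omega -> borel_tree R) :
  measurable D ->
  (forall n, measurable_fun setT (T n)) ->
  (forall w, D w -> delta (T n w) (L w) @[n --> \oo] --> 0%E) ->
  measurable_fun D L.
Proof.
move=> mD mT TL.
pose V (U : set (tree_class R)) k : set (tree_class R) :=
  [set t | exists2 e : R, k.+1%:R^-1 < e & forall t', (delta t t' < e%:E)%E -> U t'].
have V_open U k : delta_open (V U k).
  rewrite /V; move: (k.+1%:R^-1) => q t [e qe eU]; pose s := (e - q) / 2.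
  have s0 : 0 < s by rewrite /s divr_gt0// subr_gt0.
  exists s => // t' tt'; exists (e - s); first by rewrite /s; lra.
  move=> u t'u; apply: eU; apply: le_lt_trans (delta_triangle _ t' _) _.
  have -> : e = s + (e - s) by lra.
  by rewrite EFinD; apply: lteD.
have := @measurability _ _ Omega (borel_tree R) D L (@delta_open R).
apply=> // _ [U Uo <-].
rewrite (_ : D `&` L @^-1` U = D `&`
    \bigcup_k \bigcup_N \bigcap_(n in [set n | (N <= n)%N]) (T n @^-1` V U k)).
  apply: measurableI => //; apply: bigcupT_measurable => k.
  apply: bigcupT_measurable => N; apply: bigcap_measurable; first by exists N => /=.
  move=> n _; rewrite -[X in measurable X]setTI; apply: mT => //.
  by apply: measurable_delta_open; exact: V_open.
apply/seteqP; split=> w [Dw].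
  move=> /Uo[e e0 eU]; split=> //.
  have e20 : 0 < e / 2 by lra.
  have [N NP] := (ereal_cvg0P (fun n => delta_ge0 (T n w) (L w))).1 (TL w Dw) _ e20.
  pose k := Num.bound (2 / e).
  have ke : k.+1%:R^-1 < e / 2.
    rewrite -[e / 2]invf_div ltf_pV2 ?posrE ?divr_gt0//.
    have := archi_boundP (ltW (divr_gt0 (ltr0Sn R 1) e0)).
    by move=> /lt_trans; apply; rewrite ltr_nat.
  exists k => //; exists N => // n /= Nn; exists (e / 2) => // t' Tt'.
  apply: eU; apply: le_lt_trans (delta_triangle _ (T n w) _) _.
  rewrite (splitr e) EFinD; apply: lteD => //.
  by rewrite delta_sym; exact: NP.
move=> [k _ [N _ NP]]; split=> //.
have k0 : 0 < k.+1%:R^-1 :> R by rewrite invr_gt0.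
have [M MP] := (ereal_cvg0P (fun n => delta_ge0 (T n w) (L w))).1 (TL w Dw) _ k0.
have [e ke eU] := NP (maxn N M) (leq_maxl _ _).
by apply: eU; apply: lt_trans (MP _ (leq_maxr _ _)) _; rewrite lte_fin.
Qed.

End limit_measurable.

(** * Limits of chains of trees *)

Section chain.
Context {R : realType} (T : nat -> clcr_tree R) (f : forall n, T n -> T n.+1).
Hypothesis fi : forall n, isometric_embedding (@f n).

Definition chain_point := {n : nat & points (T n)}.

Implicit Types p q : chain_point.

Definition chain_in n (x : T n) : chain_point := existT _ n x.

Definition chain_up p : chain_point := chain_in (f (tagged p)).

(* The image of [p] in [T n], when [tag p <= n]. *)
Definition chain_at n p : T n :=
  tagged_as (chain_in (root (T n))) (iter (n - tag p) chain_up p).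

Definition chain_dist p q : R :=
  let n := maxn (tag p) (tag q) in mdist (chain_at n p) (chain_at n q).

Let tag_iter k p : tag (iter k chain_up p) = (k + tag p)%N.
Proof. by elim: k => //= k ->. Qed.

Lemma chain_inK n (x : T n) : chain_at n (chain_in x) = x.
Proof. by rewrite /chain_at subnn /= tagged_asE. Qed.

Lemma chain_atS n p : (tag p <= n)%N -> chain_at n.+1 p = f (chain_at n p).
Proof.
move=> pn; rewrite /chain_at subSn//=.
have : tag (iter (n - tag p) chain_up p) = n by rewrite tag_iter subnK.
case: (iter _ _ _) => m x /= mn; subst m.
by rewrite /chain_up /= !tagged_asE.
Qed.

Lemma chain_distE n p q : (tag p <= n)%N -> (tag q <= n)%N ->
  chain_dist p q = mdist (chain_at n p) (chain_at n q).
Proof.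
move=> pn qn; have mn : (maxn (tag p) (tag q) <= n)%N by rewrite geq_max pn.
rewrite /chain_dist -(subnK mn); elim: (n - _)%N => [//|k ->].
by rewrite addSn !chain_atS ?fi// (leq_trans _ (leq_addl _ _))// leq_max leqnn ?orbT.
Qed.

Lemma chain_dist_in n (x y : T n) :
  chain_dist (chain_in x) (chain_in y) = mdist x y.
Proof. by rewrite (@chain_distE n)// !chain_inK. Qed.

Lemma chain_distxx p : chain_dist p p = 0.
Proof. by rewrite /chain_dist mdistxx. Qed.

Lemma chain_distC p q : chain_dist p q = chain_dist q p.
Proof. by rewrite /chain_dist maxnC metric_sym. Qed.

Lemma chain_dist_triangle p q r :
  chain_dist p r <= chain_dist p q + chain_dist q r.
Proof.
pose n := maxn (tag p) (maxn (tag q) (tag r)).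
rewrite !(@chain_distE n) ?leq_max ?leqnn ?orbT//.
exact: metric_triangle.
Qed.

Definition chain_limit : metric_space R := completion chain_distxx.

Definition chain_emb n (x : T n) : chain_limit :=
  to_completion chain_distxx chain_distC chain_dist_triangle (chain_in x).

Lemma chain_emb_isometric n : isometric_embedding (@chain_emb n).
Proof. by move=> x y; rewrite mdist_to_completion chain_dist_in. Qed.

Lemma chain_embS n (x : T n) : chain_emb (f x) = chain_emb x.
Proof.
apply: mdist_positivity; rewrite mdist_to_completion (@chain_distE n.+1)//.
by rewrite chain_inK (@chain_atS n)// chain_inK mdistxx.
Qed.

Lemma chain_emb_dense (c : chain_limit) e : 0 < e ->
  exists n (x : T n), mdist c (chain_emb x) < e.
Proof.
move=> e0; have [[n x] cx] := to_completion_dense chain_distC chain_dist_triangle c e0.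
by exists n, x.
Qed.

Let dense (c : chain_limit) e : 0 < e ->
  exists p : chain_point, mdist c (chain_emb (tagged p)) < e.
Proof. by move=> /(chain_emb_dense c)[n [x cx]]; exists (chain_in x). Qed.

Lemma chain_limit_complete : complete_space chain_limit.
Proof. exact: completion_complete. Qed.

Let embE n p : (tag p <= n)%N -> chain_emb (tagged p) = chain_emb (chain_at n p).
Proof.
move=> pn; apply: mdist_positivity; rewrite mdist_to_completion.
have -> : chain_in (tagged p) = p by case: (p).
by rewrite (@chain_distE n)// chain_inK mdistxx.
Qed.

Lemma chain_limit_four_point : four_point chain_limit.
Proof.
apply: dense_four_point dense _ => p q r s.
pose n := maxn (maxn (tag p) (tag q)) (maxn (tag r) (tag s)).
rewrite (@embE n p) ?(@embE n q) ?(@embE n r) ?(@embE n s);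
  rewrite ?leq_max ?leqnn ?orbT//.
rewrite !chain_emb_isometric; exact: tree_four_point.
Qed.

Lemma chain_limit_geodesic : geodesic_space chain_limit.
Proof.
apply: dense_geodesic_space dense chain_limit_complete chain_limit_four_point _.
move=> p q u; pose n := maxn (tag p) (tag q).
rewrite (@embE n p) ?(@embE n q); rewrite ?leq_max ?leqnn ?orbT//.
rewrite chain_emb_isometric => /between_point[z pz zu].
exists (chain_in z); rewrite /= chain_emb_isometric//.
by move: pz; rewrite /between zu => <-; rewrite addrC addKr.
Qed.

End chain.

Lemma Zset_embedding {R : realType} (h a : R) (T1 T2 : clcr_tree R) (f : T1 -> T2) x :
  0 < a -> 0 <= h -> isometric_embedding f -> f (root T1) = root T2 ->
  Zset h a T1 x -> Zset h a T2 (f x).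
Proof.
move=> a0 h0 fi fr /(ZsetP _ a0 h0)[xa [y yx xy]]; apply/(ZsetP _ a0 h0).
rewrite -fr fi; split=> //; exists (f y); last by rewrite fi.
by rewrite /between !fi.
Qed.

Section exhaustion.
Context {R : realType} (T : nat -> clcr_tree R) (C : metric_space R) (r : C).
Variable emb : forall n, T n -> C.
Hypothesis embi : forall n, isometric_embedding (@emb n).
Hypothesis embr : forall n, emb (root (T n)) = r.
Hypothesis embS : forall n (x : T n), exists y : T n.+1, emb y = emb x.
Hypothesis emb_dense : forall (c : C) e, 0 < e ->
  exists n (x : T n), mdist c (emb x) < e.

Let mesh (m : nat) : R := m.+1%:R^-1.

Hypothesis Zbounded : forall m j, exists M, forall n,
  (tree_Z (mesh m) (j.+1%:R * mesh m) (T n) <= M)%N.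

Let mesh0 m : 0 < mesh m. Proof. by rewrite /mesh invr_gt0. Qed.

Let level0 m j : 0 < j.+1%:R * mesh m. Proof. by rewrite mulr_gt0. Qed.

Lemma emb_lift N n : (N <= n)%N -> exists g : T N -> T n,
  [/\ forall x, emb (g x) = emb x, isometric_embedding g & g (root (T N)) = root (T n)].
Proof.
move=> Nn; have [k ->] : exists k, n = (k + N)%N by exists (n - N)%N; rewrite subnK.
suff [g gE] : exists g : T N -> T (k + N), forall x, emb (g x) = emb x.
  exists g; split=> // [x y|]; first by rewrite -embi !gE embi.
  by apply: (isometric_embedding_inj (@embi _)); rewrite gE !embr.
elim: k => [|k [g gE]]; first by exists id.
have /(_ _)/cid-/all_sig[g' g'E] := @embS (k + N)%N.
by exists (g' \o g) => x /=; rewrite g'E gE.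
Qed.

Let captures h a N := forall n (x : T n), Zset h a (T n) x ->
  exists2 y, Zset h a (T N) y & emb y = emb x.

Let captures_le h a N n : 0 < a -> 0 <= h -> (N <= n)%N ->
  captures h a N -> captures h a n.
Proof.
move=> a0 h0 Nn cN k x /cN[y Zy yx]; have [g [gE gi gr]] := emb_lift Nn.
by exists (g y); [exact: Zset_embedding Zy|rewrite gE].
Qed.

(* Past the index where the bounded monotone count is maximal, the sets [Zset]
   are carried onto each other. *)
Let captures_ex m j : exists N, captures (mesh m) (j.+1%:R * mesh m) N.
Proof.
set h := mesh m; set a := _ * _.
have [h0 a0] : 0 < h /\ 0 < a by split; [exact: mesh0|exact: level0].
have [M ZM] := Zbounded m j.
have [N Nmax] : exists N, forall n, (tree_Z h a (T n) <= tree_Z h a (T N))%N.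
  have exn : exists n, `[< exists k, tree_Z h a (T k) = n >].
    by exists (tree_Z h a (T 0%N)); apply/asboolP; exists 0%N.
  have ub n : `[< exists k, tree_Z h a (T k) = n >] -> (n <= M)%N.
    by move=> /asboolP[k <-]; exact: ZM.
  case: (ex_maxnP exn ub) => n /asboolP[N <-] nmax; exists N => k.
  by apply: nmax; apply/asboolP; exists k.
exists N => n x Zx.
have [g [gE gi gr]] := emb_lift (leq_maxl N n).
have [g' [g'E g'i g'r]] := emb_lift (leq_maxr N n).
set k := maxn N n in g gE gi gr g' g'E g'i g'r.
have finN : finite_set (Zset h a (T N)) by exact: Zset_finite.
have fink : finite_set (Zset h a (T k)) by exact: Zset_finite.
have gsub : g @` Zset h a (T N) `<=` Zset h a (T k).
  by move=> _ [y Zy <-]; exact: (Zset_embedding a0 (ltW h0)).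
have E : fset_set (g @` Zset h a (T N)) = fset_set (Zset h a (T k)).
  apply/eqP; rewrite eqEfcard; apply/andP; split.
    by rewrite -fset_set_sub//; exact: finite_image.
  rewrite fset_set_image// card_imfset//=; last exact: isometric_embedding_inj.
  exact: Nmax.
have : (g @` Zset h a (T N)) (g' x).
  rewrite -(fset_setK (finite_image g finN)) E fset_setK//.
  exact: (Zset_embedding a0 (ltW h0)).
by move=> [y Zy gy]; exists y => //; rewrite -gE gy g'E.
Qed.

Let captures_all m J : exists N, forall j, (j < J)%N ->
  captures (mesh m) (j.+1%:R * mesh m) N.
Proof.
elim: J => [|J [N NP]]; first by exists 0%N.
have [N' N'P] := captures_ex m J; exists (maxn N N') => j.
rewrite ltnS leq_eqVlt => /orP[/eqP ->|/NP].
  by apply: captures_le N'P; rewrite ?leq_maxr// ltW.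
by apply: captures_le; rewrite ?leq_maxl// ltW.
Qed.

Let tree_net m c : 0 <= c -> exists N (s : seq (T N)),
  forall n (x : T n), mdist (root (T n)) x <= c + mesh m ->
    exists2 y, y \in s & mdist (root (T N)) y <= c /\
      mdist (emb x) (emb y) < 2 * mesh m.
Proof.
move=> c0; pose h := mesh m; have h0 : 0 < h by exact: mesh0.
pose J := Num.bound (c / h).
have [N NP] := captures_all m J.
exists N, (root (T N) :: flatten [seq (fset_set (Zset h (j.+1%:R * h) (T N)) : seq _)
  | j <- iota 0 J]) => n x; rewrite -/h; set a := mdist _ x => ac.
have [ah|ah] := ltP a (2 * h).
  exists (root (T N)); rewrite ?mem_head// mdistxx; split=> //.
  by rewrite embr -(embr n) embi metric_sym.
have ah0 : 0 <= (a - h) / h by rewrite divr_ge0 ?(ltW h0)//; lra.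
have /andP[] := truncn_itv ah0.
case: (Num.truncn _) => [|j].
  by rewrite ltr_pdivrMr// mul1r => _; lra.
rewrite ler_pdivlMr// ltr_pdivrMr// -[j.+2]addn1 natrD mulrDl mul1r => jl jr.
have jJ : (j < J)%N.
  apply: ltnW; rewrite -(ltr_nat R).
  apply: le_lt_trans (archi_boundP (divr_ge0 c0 (ltW h0))).
  by rewrite ler_pdivlMr//; lra.
have [|z xz rz] := @between_point R (T n) (root (T n)) x (j.+1%:R * h).
  by rewrite ltW ?level0//= -/a; lra.
have zx : mdist z x = a - j.+1%:R * h by move: xz; rewrite /between rz -/a => <-; lra.
have Zz : Zset h (j.+1%:R * h) (T n) z.
  split=> //; right; exists x; rewrite zx; split; last by lra.
  exact/(segmentE (@tree_four_point R (T n)) (@tree_geodesic R (T n))).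
have [y Zy yz] := NP j jJ n z Zz.
exists y; last first.
  have ry : mdist (root (T N)) y = j.+1%:R * h by case: Zy.
  split; first by rewrite ry; lra.
  by rewrite yz embi metric_sym zx; lra.
rewrite inE; apply/orP; right; apply/flattenP.
exists (fset_set (Zset h (j.+1%:R * h) (T N)) : seq _).
  by apply/mapP; exists j; rewrite ?mem_iota.
rewrite in_fset_set ?inE//; apply: Zset_finite => //; exact: level0.
Qed.

Lemma exhaustion_net (c e : R) : 0 <= c -> 0 < e -> exists N (s : seq (T N)),
  forall p : C, mdist r p <= c -> exists2 y, y \in s &
    mdist (root (T N)) y <= c /\ mdist p (emb y) < e.
Proof.
move=> c0 e0; pose m := Num.bound (3 / e).
have me : 3 * mesh m < e.
  rewrite /mesh ltr_pdivrMr// mulrC -ltr_pdivrMr//.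
  apply: lt_trans (archi_boundP (divr_ge0 _ (ltW e0))) _ => //.
  by rewrite ltr_nat.
have [N [s sP]] := tree_net m c0; exists N, s => p rp.
have [n [x px]] := emb_dense p (mesh0 m).
have [|y ys [yc xy]] := sP n x.
  rewrite -(@embi n) embr; have := metric_triangle r p (emb x) => *; lra.
exists y => //; split=> //.
by have := metric_triangle p (emb x) (emb y) => *; lra.
Qed.

Lemma exhaustion_locally_compact :
  complete_space C -> locally_compact [set: C].
Proof.
move=> Cc x _; exists [set y | mdist r y <= mdist r x + 1].
  rewrite withinET; apply/nbhs_ballP; exists 1 => //= y; rewrite ballEmdist/=.
  by have := metric_triangle r x y => *; lra.
split; last exact: closed_mdist_le.
apply: totally_bounded_compact => //; first exact: closed_mdist_le.
move=> e e0; have c0 : 0 <= mdist r x + 1 by rewrite addr_ge0 ?mdist_ge0.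
have [N [s sP]] := exhaustion_net c0 e0.
exists [seq emb y | y <- s] => p /sP[y ys [_ py]].
by exists (emb y); [exact: map_f|rewrite metric_sym].
Qed.

Let emb_cross_dist (n k : nat) :
  cross_dist (fun (x : ball_space (root (T n)) k%:R) (y : ball_space r k%:R) =>
    mdist (emb (val x)) (val y)).
Proof.
split=> [x x' y|x y y'|x x' y|x y y'].
- by rewrite -[mdist x x']/(mdist (val x) (val x')) -embi; exact: metric_triangle.
- exact: metric_triangle.
- rewrite -[mdist x x']/(mdist (val x) (val x')) -embi (metric_sym (emb (val x'))).
  exact: metric_triangle.
- rewrite -[mdist y y']/(mdist (val y) (val y')) (metric_sym (emb (val x))).
  exact: metric_triangle.
Qed.

Lemma exhaustion_delta_cpct (k : nat) (e : R) : 0 < e ->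
  exists N, forall n, (N <= n)%N ->
  (delta_cpct (ball_root (root (T n)) k) (ball_root r k) <= e%:E)%E.
Proof.
move=> e0; have [N [s sP]] := exhaustion_net (ler0n R k) e0; exists N => n Nn.
have [g [gE gi gr]] := emb_lift Nn.
have xk (x : ball_space (root (T n)) k%:R) : mdist r (emb (val x)) <= k%:R.
  by rewrite -(embr n) embi; exact: valP x.
apply: (coupling_delta_cpct (c := fun (x : ball_space (root (T n)) k%:R)
  (y : ball_space r k%:R) => mdist (emb (val x)) (val y))).
split; first exact: emb_cross_dist.
split=> [x|[y /= yk]|/=]; last by rewrite embr mdistxx.
  by exists (exist _ (emb (val x)) (xk x)); rewrite /= mdistxx.
have [z zs [zk yz]] := sP y yk.
have gzk : mdist (root (T n)) (g z) <= k%:R by rewrite -gr gi.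
by exists (exist _ (g z) gzk); rewrite /= gE metric_sym.
Qed.

Lemma exhaustion_delta_cpct_le (k n : nat) :
  (delta_cpct (ball_root (root (T n)) k) (ball_root r k) <= k.+1%:R%:E)%E.
Proof.
have xk (x : ball_space (root (T n)) k%:R) : mdist r (emb (val x)) <= k%:R.
  by rewrite -(embr n) embi; exact: valP x.
apply: (coupling_delta_cpct (c := fun (x : ball_space (root (T n)) k%:R)
  (y : ball_space r k%:R) => mdist (emb (val x)) (val y))).
split; first exact: emb_cross_dist.
have k1 : k%:R < k.+1%:R :> R by rewrite ltr_nat.
split=> [x|[y /= yk]|/=]; last by rewrite embr mdistxx.
- exists (ball_root r k); rewrite /= metric_sym; exact: le_lt_trans (xk x) k1.
- exists (ball_root (root (T n)) k); rewrite /= embr; exact: le_lt_trans yk k1.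
Qed.

End exhaustion.

Section geometric_majorant.
Context {R : realType}.

Lemma geometric_eseries_le (u : nat -> \bar R) (e : R) :
  (forall k, 0 <= u k)%E -> (forall k, u k <= (e * (7 / 8) ^+ k)%:E)%E -> 0 <= e ->
  (\sum_(1 <= k <oo) u k <= (8 * e)%:E)%E.
Proof.
move=> u0 ue e0; apply: lime_le; first exact: is_cvg_nneseries.
apply: nearW => n; apply: (@le_trans _ _ (\sum_(1 <= k < n) (e * (7 / 8) ^+ k)%:E)%E).
  exact: lee_sum.
rewrite sumEFin lee_fin -mulr_sumr mulrC ler_wpM2r//.
suff h k : \sum_(1 <= i < k.+1) (7 / 8 : R) ^+ i = 7 - 7 * (7 / 8) ^+ k.
  case: n => [|n]; first by rewrite big_geq.
  by rewrite h; have : 0 <= (7 / 8 : R) ^+ n; [rewrite exprn_ge0// divr_ge0|lra].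
elim: k => [|k ih]; first by rewrite big_geq// expr0; lra.
by rewrite big_nat_recr//= ih exprS; lra.
Qed.

Lemma natS_le_geometric k : k.+1%:R <= 2 * (3 / 2 : R) ^+ k.
Proof.
suff : k.+2%:R <= 2 * (3 / 2 : R) ^+ k.
  by apply: le_trans; rewrite ler_nat.
elim: k => [|k ih]; first by rewrite expr0; lra.
rewrite exprS; have : 0 <= k%:R :> R by rewrite ler0n.
by move: ih; rewrite -[k.+3]addn3 -[k.+2]addn2 !natrD; lra.
Qed.

End geometric_majorant.

Section chain_converges.
Context {R : realType}.

Lemma chain_converges (T : nat -> clcr_tree R) :
  (forall n, exists2 f : T n -> T n.+1, isometric_embedding f &
     f (root (T n)) = root (T n.+1)) ->
  (forall m j, exists M, forall n,
     (tree_Z m.+1%:R^-1 (j.+1%:R * m.+1%:R^-1) (T n) <= M)%N) ->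
  exists L : clcr_tree R, forall e : R, 0 < e -> exists N, forall n, (N <= n)%N ->
    (tree_dist (T n) L <= e%:E)%E.
Proof.
move=> /(_ _)/cid2-/all_sig2[f fi fr] Zb.
pose C := chain_limit f.
pose emb n (x : T n) : C := chain_emb fi x.
have embi n : isometric_embedding (@emb n) by exact: chain_emb_isometric.
have embS n (x : T n) : exists y : T n.+1, emb _ y = emb _ x.
  by exists (f n x); exact: chain_embS.
pose r : C := emb 0%N (root (T 0%N)).
have embr n : emb n (root (T n)) = r.
  by elim: n => [//|n <-]; rewrite -fr; exact: chain_embS.
have embd (c : C) e : 0 < e -> exists n (x : T n), mdist c (emb n x) < e.
  exact: chain_emb_dense.
have Ctree : real_tree C.
  apply: four_point_real_tree; first exact: chain_limit_four_point.
  exact: chain_limit_geodesic.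
have Cc : complete_space C by exact: chain_limit_complete.
have Clc : locally_compact [set: C].
  exact: exhaustion_locally_compact embi embr embS embd Zb Cc.
exists (ClcrTree r Ctree Cc Clc) => e e0.
have e80 : 0 < e / 8 by lra.
have [K KP] : exists K, forall k, (K <= k)%N -> 2 * (6 / 7 : R) ^+ k <= e / 8.
  have : 2 * (6 / 7 : R) ^+ k @[k --> \oo] --> (2 * 0 : R).
    by apply: cvgM; [exact: cvg_cst|apply: cvg_expr; rewrite ger0_norm; lra].
  rewrite mulr0 => /cvgrPdist_lt/(_ _ e80)[K _ KP]; exists K => k /KP/=.
  by rewrite sub0r normrN ger0_norm ?mulr_ge0 ?exprn_ge0 ?divr_ge0// => /ltW.
have [N NP] : exists N, forall k, (k < K)%N -> forall n, (N <= n)%N ->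
    (delta_cpct (ball_root (root (T n)) k) (ball_root r k) <=
      (e / 8 * (7 / 8) ^+ k)%:E)%E.
  elim: K {KP} => [|K [N NP]]; first by exists 0%N.
  have q0 : 0 < e / 8 * (7 / 8 : R) ^+ K by rewrite mulr_gt0 ?exprn_gt0 ?divr_gt0.
  have [M MP] := exhaustion_delta_cpct embi embr embS embd Zb K q0.
  exists (maxn N M) => k; rewrite ltnS leq_eqVlt => /orP[/eqP ->|kK] n.
    by rewrite geq_max => /andP[_]; exact: MP.
  by rewrite geq_max => /andP[+ _]; exact: NP.
exists N => n Nn.
have -> : e = 8 * (e / 8) by lra.
apply: geometric_eseries_le => [k|k|]; last exact: ltW.
  by rewrite mule_ge0 ?delta_cpct_ge0// lee_fin exprn_ge0.
have k20 : 0 <= (2^-1 : R) ^+ k by rewrite exprn_ge0.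
have [kK|Kk] := ltnP k K.
  apply: le_trans (_ : (1 * (e / 8 * (7 / 8) ^+ k)%:E <= _)%E); last by rewrite mul1e.
  apply: lee_pmul; rewrite ?delta_cpct_ge0 ?lee_fin//; last exact: NP.
  by rewrite exprn_ile1// invf_le1// ler1n.
apply: le_trans (_ : ((2^-1 ^+ k)%:E * k.+1%:R%:E <= _)%E).
  rewrite lee_wpmul2l ?lee_fin//.
  exact: (exhaustion_delta_cpct_le embi embr).
rewrite -EFinM lee_fin; apply: (@le_trans _ _ (2^-1 ^+ k * (2 * (3 / 2) ^+ k))).
  by rewrite ler_wpM2l// natS_le_geometric.
rewrite mulrCA -exprMn (_ : 2^-1 * (3 / 2) = 6 / 7 * (7 / 8)); last by lra.
by rewrite exprMn mulrA ler_wpM2r ?KP// exprn_ge0// divr_ge0.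
Qed.

End chain_converges.

(** * Almost sure convergence *)

Lemma compact_nat_bounded (K : set nat) : compact K ->
  exists M, forall x, K x -> (x <= M)%N.
Proof.
move=> Kc; apply: contrapT => nK.
pose F : set_system nat := fun B => exists M, forall x, K x -> (M < x)%N -> B x.
have FF : ProperFilter F.
  split=> [[M MP]|].
    by apply: nK; exists M => x Kx; rewrite leqNgt; apply/negP => /(MP x Kx).
  split=> [|A B [M MP] [N NP]|A B AB [M MP]]; first by exists 0%N.
  - exists (maxn M N) => x Kx; rewrite gtn_max => /andP[Mx Nx].
    by split; [exact: MP|exact: NP].
  - by exists M => x Kx /(MP x Kx)/AB.
have [|p [Kp pF]] := Kc F FF; first by exists 0%N.
have [x [/= px xp]] : [set x | (p < x)%N] `&` [set p] !=set0.
  by apply: pF; [exists p|exact: discrete_set1].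
by rewrite xp ltnn in px.
Qed.

Section random_trees.
Context {R : realType} {d : measure_display} {Omega : measurableType d}
  (P : probability Omega R).

Lemma tight_ae_bounded (u : nat -> Omega -> nat) :
  (forall n m, measurable [set w | (m <= u n w)%N]) ->
  {ae P, forall w, forall n, (u n w <= u n.+1 w)%N} ->
  tight (fun n => pushforward P (u n)) ->
  {ae P, forall w, exists M, forall n, (u n w <= M)%N}.
Proof.
move=> mu [A [mA PA0 Au]] ut.
have umono w : ~ A w -> forall n k, (n <= k)%N -> (u n w <= u k w)%N.
  move=> nAw n k; have {}Aw : forall n, (u n w <= u n.+1 w)%N.
    by apply: contrapT => h; apply: nAw; exact: Au.
  by move=> /subnK <-; elim: (_ - _)%N => // j ih; apply: leq_trans ih (Aw _).
pose F M n := [set w | (M < u n w)%N] `\` A.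
have mF M n : measurable (F M n) by apply: measurableD => //; exact: mu.
pose B := \bigcap_M \bigcup_n F M n.
have mB : measurable B.
  by apply: bigcap_measurable => [|M _]; [exists 0%N|exact: bigcup_measurable].
have PB0 : P B = 0%E.
  apply/eqP; rewrite eq_le measure_ge0 andbT; apply/lee_addgt0Pr => e e0.
  rewrite add0e; have [K /compact_nat_bounded[M MP] PK] := ut e e0.
  apply: (@le_trans _ _ (P (\bigcup_n F M n))).
    apply: le_measure; rewrite ?inE//; first exact: bigcup_measurable.
    by move=> w /(_ M I).
  have Fcvg : P (F M n) @[n --> \oo] --> P (\bigcup_n F M n).
    apply: nondecreasing_cvg_mu => //; first exact: bigcup_measurable.
    apply/nondecreasing_seqP => n; rewrite /F; apply/subsetPset => w [Mw nAw].
    by split=> //; apply: leq_trans Mw _; exact: umono.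
  apply: (@cvge_le _ _ _ _ _ _ _ _ Fcvg) => //; apply: nearW => n /=.
  apply: le_trans (PK n); rewrite /pushforward.
  have muC : measurable (u n @^-1` (~` K)).
    have -> : u n @^-1` (~` K) = \bigcup_(m in ~` K)
        ([set w | (m <= u n w)%N] `\` [set w | (m < u n w)%N]).
      apply/seteqP; split=> [w /= nK|w [m nK [/= mw]]].
        by exists (u n w) => //; split; rewrite /= ?leqnn ?ltnn.
      by move=> /negP; rewrite -leqNgt => wm; rewrite (@anti_leq (u n w) m) ?wm.
    by apply: bigcup_measurable => m _; apply: measurableD; exact: mu.
  apply: le_measure; rewrite ?inE//.
  by move=> w [/= Mw _] /MP; rewrite leqNgt Mw.
exists (A `|` B); split; first exact: measurableU.
  have PA : P A = 0%E := PA0.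
  apply/eqP; rewrite eq_le measure_ge0 andbT.
  apply: (@le_trans _ _ (P A + P B)%E); last by rewrite PA PB0 adde0.
  exact: measureU2.
move=> w /= nM; have [Aw|nAw] := pselect (A w); [by left|right] => M _.
apply: contrapT => nF; apply: nM; exists M => n; rewrite leqNgt; apply/negP => Mu.
by apply: nF; exists n.
Qed.

End random_trees.

Lemma preceq_repr {R : realType} (t1 t2 : tree_class R) : preceq t1 t2 ->
  exists2 f : repr t1 -> repr t2, isometric_embedding f &
    f (root (repr t1)) = root (repr t2).
Proof.
move=> [T1 [T2 [<- <- [f fi fr]]]].
have [g1 [gi1 gr1 _]] := repr_pi_isom T1.
have [g2 [gi2 gr2 _]] := rooted_isometric_sym (repr_pi_isom T2).
exists (g2 \o (f \o g1)); first by move=> x y /=; rewrite gi2 fi gi1.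
by rewrite /= gr1 fr gr2.
Qed.

Theorem theorem2p15 (R : realType) (d : measure_display)
    (Omega : measurableType d) (P : probability Omega R)
    (T : nat -> {RV P >-> borel_tree R}) :
  (forall n : nat, {ae P, forall w, preceq (T n w) (T n.+1 w)}) ->
  (forall a h : R, 0 < a -> 0 < h ->
     tight (fun n : nat => pushforward P (fun w => Z h a (T n w)))) ->
  exists Tlim : {RV P >-> borel_tree R},
    {ae P, forall w, delta (T n w) (Tlim w) @[n --> \oo] --> 0%E}.
Proof.
move=> Tinc Ttight.
have mT n : measurable_fun setT (T n : Omega -> borel_tree R) by [].
have inc : {ae P, forall w, forall n, preceq (T n w) (T n.+1 w)}.
  exact: ae_foralln.
have bnd : {ae P, forall w, forall m j, exists M, forall n,
    (Z m.+1%:R^-1 (j.+1%:R * m.+1%:R^-1) (T n w) <= M)%N}.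
  apply: ae_foralln => m; apply: ae_foralln => j.
  have h0 : 0 < m.+1%:R^-1 :> R by rewrite invr_gt0.
  have a0 : 0 < j.+1%:R * m.+1%:R^-1 :> R by rewrite mulr_gt0.
  apply: tight_ae_bounded (Ttight _ _ a0 h0) => [n k|].
    have := mT n measurableT _ (measurable_Z_ge k a0 h0).
    by rewrite setTI.
  apply: filterS inc => w Tw n; have [f fi fr] := preceq_repr (Tw n).
  exact: tree_Z_embedding fr.
have [A [mA PA0 AP]] : {ae P, forall w, exists L : tree_class R,
    delta (T n w) L @[n --> \oo] --> 0%E}.
  apply: filterS2 inc bnd => w Tw Zw.
  have [L LP] := @chain_converges R (fun n => repr (T n w))
    (fun n => preceq_repr (Tw n)) Zw.
  exists (\pi_(tree_class R) L)%qT.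
  apply/ereal_cvg0P => [n|e e0]; first exact: delta_ge0.
  have e20 : 0 < e / 2 by lra.
  have [N NP] := LP _ e20; exists N => n /NP; rewrite -delta_pi reprK => h.
  by apply: le_lt_trans h _; rewrite lte_fin; lra.
have /(_ _)/cid-/all_sig[L LP] : forall w, exists L : borel_tree R,
    (~ A w -> delta (T n w) L @[n --> \oo] --> 0%E) /\ (A w -> L = point).
  move=> w; have [Aw|nAw] := pselect (A w); first by exists point.
  have [L TL] : exists L : tree_class R, delta (T n w) L @[n --> \oo] --> 0%E.
    by apply: contrapT => h; apply: nAw; exact: AP.
  by exists L.
have mL : measurable_fun setT L.
  rewrite -(setvU A); apply/measurable_funU => //; first exact: measurableC.
  split.
    apply: (measurable_delta_limit (T := T)) => //; first exact: measurableC.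
    by move=> w nAw; exact: (LP w).1.
  apply: (eq_measurable_fun (cst point)) => // w /set_mem Aw.
  by rewrite (LP w).2.
pose mLmix := isMeasurableFun.Build _ _ _ _ L mL.
pose Lm : {RV P >-> borel_tree R} := HB.pack L mLmix.
exists Lm; exists A; split=> // w /= nTL; apply: contrapT => nAw; apply: nTL.
exact: (LP w).1.
Qed.
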